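(* Let $d>2$, let $\mathcal S\in\mathrm S^d\mathbb C^2$, $\mathcal S\ne0$, and associate with $\mathcal S$ the vector $\mathbf s=(s_0,\ldots,s_d)^\top\in\mathbb C^{d+1}$. Let $\phi(z)=\sum_{j=0}^d\binom djs_jz^j$, and $$p(z)=\sum_{j=0}^{d-1}\binom{d-1}js_{j+1}z^j,\qquad q(z)=\sum_{j=0}^{d-1}\binom{d-1}js_jz^j,$$ $$u(z)=\sum_{j=0}^{d-1}\binom{d-1}j\overline{s_{j+1}}\,p(z)^jq(z)^{d-1-j},\qquad v(z)=\sum_{j=0}^{d-1}\binom{d-1}j\overline{s_j}\,p(z)^jq(z)^{d-1-j}.$$ (1) The polynomial $zv(z)-u(z)$ is the zero polynomial if and only if one of the following conditions holds. Either, for some $k\in\{1,\dots,d-1\}$ and some nonzero scalar $A$, $s_k=A$ and $s_j=0$ for $j\ne k$ (i.e. $f(\mathbf x)=\mathcal S\times\otimes^d\mathbf x=A\binom dkx_1^{d-k}x_2^k$). For this $\mathcal S\in\mathrm S^d\mathbb F^2$ we have $$\|\mathcal S\|_{\sigma,\mathbb F}=|A|\binom dk\Big(1-\frac kd\Big)^{\frac{d-k}2}\Big(\frac kd\Big)^{\frac k2}.$$ Or $\mathcal S$ has corresponding $\phi$ given by $$\phi(z)=A(z+a)^{m}(z+b)^{d-m},\quad A\ne0,\quad a=e^{-\theta\mathrm i}c,\ \ b=-e^{-\theta\mathrm i}c^{-1},\ \ c\in\mathbb R\setminus\{0\},\ \theta\in\mathbb R,\ m\in\{1,\dots,d-1\}.$$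 In this second case $\|\mathcal S\|_\sigma$ can be computed to an arbitrary precision. (2) Let $R_1=\{z\in\mathbb C:\ zv(z)-u(z)=0\}$. Suppose that $\mathcal S\in\mathrm S^d\mathbb C^2$ is not of either of the forms given in (1). (Hence the set $R_1$ is finite.) Then $$\|\mathcal S\|_\sigma=\max\Big\{|s_d|,\ \max\Big\{\frac{|\phi(z)|}{(1+|z|^2)^{d/2}}:\ z\in R_1\Big\}\Big\}.$$ (3) Assume that $\mathcal S\in\mathrm S^d\mathbb R^2$. Let $R=\{z\in\mathbb C:\ zq(z)-p(z)=0\}$ and $R'=R\cap\mathbb R$. Then $zq(z)-p(z)$ is the zero polynomial if and only if $d$ is even and $\phi(z)=A(z^2+1)^{d/2}$ for some scalar $A$. In this case $\|\mathcal S\|_{\sigma,\mathbb R}=|A|$. Assume that $\phi(z)$ is not of the form $A(z^2+1)^{d/2}$. Then $$\|\mathcal S\|_{\sigma,\mathbb R}=\max\Big\{|s_d|,\ \max\Big\{\frac{|\phi(z)|}{(1+|z|^2)^{d/2}}:\ z\in R'\Big\}\Big\}.$$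
   Context: $\mathbb F\in\{\mathbb R,\mathbb C\}$. $\mathrm S^d\mathbb F^2$ is the space of symmetric $d$-mode tensors $\mathcal S=[\mathcal S_{i_1,\dots,i_d}]$, $i_k\in\{1,2\}$, with entries in $\mathbb F$. The vector $\mathbf s=(s_0,\dots,s_d)^\top$ associated with $\mathcal S$ is defined by $\mathcal S_{i_1,\ldots,i_d}=s_k$ if exactly $k$ of the indices $i_1,\ldots,i_d$ are equal to $2$. For $\mathbf x=(x_1,x_2)^\top$, $\mathcal S\times\otimes^d\mathbf x=\sum\mathcal S_{i_1,\ldots,i_d}x_{i_1}\cdots x_{i_d}=\sum_{j=0}^d\binom djs_jx_1^{d-j}x_2^j$. The spectral norm is $\|\mathcal S\|_{\sigma,\mathbb F}=\max\{|\mathcal S\times\otimes^d\mathbf x|:\mathbf x\in\mathbb F^2,\|\mathbf x\|=1\}$, and $\|\mathcal S\|_\sigma=\|\mathcal S\|_{\sigma,\mathbb C}$. A maximum over an empty set is omitted. *)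

(* Defs.v *)
(* The complex numbers are R[i] for an arbitrary realType R, and S^d R^2 is seen
   inside S^d C^2, as the symmetric tensors with real entries. *)
From HB Require Import structures.
From mathcomp Require Import all_boot all_order all_algebra all_fingroup.
From mathcomp Require Import all_classical all_reals all_analysis.
From mathcomp Require Import complex.

Set Implicit Arguments.
Unset Strict Implicit.
Unset Printing Implicit Defensive.

Import Order.TTheory GRing.Theory Num.Theory.
Import numFieldNormedType.Exports.

Local Open Scope classical_set_scope.
Local Open Scope complex_scope.
Local Open Scope ring_scope.

(* The modulus of a complex number, as an element of R: the norm `|z| of
   R[i] is (normc z)%:C, an element of R[i]. *)
Notation normc := ComplexField.Normc.normc.

Definition is_maximum (R : realType) (A : set R) (r : R) : Prop :=
  A r /\ ubound A r.

Section Tensors.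
Variables (R : realType) (d : nat).
Local Notation C := R[i].

(* The index values 1 and 2 are the elements 0 and 1 of 'I_2. *)
Definition mode_index := {ffun 'I_d -> 'I_2}.

Definition tensor := {ffun mode_index -> C}.

Definition symmetric_tensor (S : tensor) : Prop :=
  forall (t : {perm 'I_d}) (i : mode_index), S [ffun k => i (t k)] = S i.

Definition twos (i : mode_index) : nat := #|[pred k | i k == 1]|.

Definition associated (S : tensor) (s : 'cV[C]_d.+1) : Prop :=
  forall i : mode_index, S i = s (inord (twos i)) 0.

Definition tensor_eval (S : tensor) (x : 'cV[C]_2) : C :=
  \sum_(i : mode_index) S i * \prod_(k < d) x (i k) 0.

Definition l2norm (x : 'cV[C]_2) : R :=
  Num.sqrt (\sum_(k < 2) normc (x k 0) ^+ 2).

Variant base_field := BaseR | BaseC.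

Definition in_base (F : base_field) (z : C) : bool :=
  if F is BaseR then z \is Num.real else true.

Definition tensor_over (F : base_field) (S : tensor) : Prop :=
  forall i, in_base F (S i).

Definition spectral_values (F : base_field) (S : tensor) : set R :=
  [set normc (tensor_eval S x) | x in
     [set x : 'cV[C]_2 | (forall k, in_base F (x k 0)) /\ l2norm x = 1]].

(* The supremum is attained: see spectral_norm_max below. *)
Definition spectral_norm (F : base_field) (S : tensor) : R :=
  sup (spectral_values F S).

End Tensors.

Section Polynomials.
Variables (R : realType) (d : nat) (s : 'cV[R[i]]_d.+1).
Local Notation C := R[i].

Definition entry (j : nat) : C := s (inord j) 0.

Definition phi_poly : {poly C} :=
  \sum_(j < d.+1) (entry j *+ 'C(d, j)) *: 'X^j.

Definition p_poly : {poly C} :=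
  \sum_(j < d) (entry j.+1 *+ 'C(d.-1, j)) *: 'X^j.

Definition q_poly : {poly C} :=
  \sum_(j < d) (entry j *+ 'C(d.-1, j)) *: 'X^j.

Definition u_poly : {poly C} :=
  \sum_(j < d) ((entry j.+1)^* *+ 'C(d.-1, j)) *:
    (p_poly ^+ j * q_poly ^+ (d.-1 - j)).

Definition v_poly : {poly C} :=
  \sum_(j < d) ((entry j)^* *+ 'C(d.-1, j)) *:
    (p_poly ^+ j * q_poly ^+ (d.-1 - j)).

Definition single_entry (k : nat) (A : C) : Prop :=
  entry k = A /\ forall j, (j <= d)%N -> j != k -> entry j = 0.

Definition monomial_form : Prop :=
  exists k A, [/\ (0 < k < d)%N, A != 0 & single_entry k A].

(* expi t is e^{i t}. *)
Definition expi (t : R) : C := cos t +i* sin t.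

Definition two_root_form : Prop :=
  exists (A : C) (c theta : R) (m : nat),
    [/\ A != 0, c != 0, (0 < m < d)%N &
        let a := expi (- theta) * c%:C in
        let b := - expi (- theta) * (c^-1)%:C in
        phi_poly = A *: (('X + a%:P) ^+ m * ('X + b%:P) ^+ (d - m))].

Definition sphere_form (A : C) : Prop :=
  ~~ odd d /\ phi_poly = A *: ('X^2 + 1) ^+ d./2.

Definition phi_ratio (z : C) : R :=
  normc phi_poly.[z] / (1 + normc z ^+ 2) `^ (d%:R / 2).

End Polynomials.

(* Computability to arbitrary precision, in the usual sense of computable
   analysis: a program of the Turing-complete while language below, whose
   registers hold rational numbers, has access to the complex vector s only
   through an oracle returning rational approximations of its entries. *)

Inductive expr :=
  | Const of rat
  | Reg of nat
  | Add of expr & expr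
  | Opp of expr
  | Mul of expr & expr
  | Inv of expr.

Definition store := nat -> rat.

Definition update (st : store) (x : nat) (a : rat) : store :=
  fun y => if y == x then a else st y.

Fixpoint eval (st : store) (e : expr) : rat :=
  match e with
  | Const a => a
  | Reg x => st x
  | Add e1 e2 => eval st e1 + eval st e2
  | Opp e1 => - eval st e1
  | Mul e1 e2 => eval st e1 * eval st e2
  | Inv e1 => (eval st e1)^-1
  end.

Definition oracle := nat -> nat -> rat * rat.

Inductive program :=
  | Assign of nat & expr
  | Query of nat & nat & expr & expr
  | Seq of program & program
  | WhilePos of expr & program.

(* exec o c st st' : started in st with oracle o, c halts in st'.  Query x y j n
   stores in x and y the two components of the answer to the query (j, n), the
   values of j and n being truncated to natural numbers. *)
Inductive exec (o : oracle) : program -> store -> store -> Prop :=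
  | ExecAssign x e st : exec o (Assign x e) st (update st x (eval st e))
  | ExecQuery x y j n st :
      let a := o (Num.truncn (eval st j)) (Num.truncn (eval st n)) in
      exec o (Query x y j n) st (update (update st x a.1) y a.2)
  | ExecSeq c1 c2 st st1 st2 :
      exec o c1 st st1 -> exec o c2 st1 st2 -> exec o (Seq c1 c2) st st2
  | ExecWhileStop e c st : eval st e <= 0 -> exec o (WhilePos e c) st st
  | ExecWhileStep e c st st1 st2 :
      0 < eval st e -> exec o c st st1 -> exec o (WhilePos e c) st1 st2 ->
      exec o (WhilePos e c) st st2.

Definition approximates (R : realType) (d : nat) (o : oracle)
    (s : 'cV[R[i]]_d.+1) : Prop :=
  forall j n, (j <= d)%N ->
    `|complex.Re (entry s j) - ratr (o j n).1| <= 2 ^- n /\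
    `|complex.Im (entry s j) - ratr (o j n).2| <= 2 ^- n.

(* Initially register 0 holds d and register 1 the requested precision n;
   the result is read off register 0. *)
Definition initial (d n : nat) : store :=
  update (update (fun=> 0) 0 d%:R) 1 n%:R.

Definition computes (R : realType) (d : nat) (alg : program)
    (s : 'cV[R[i]]_d.+1) (r : R) : Prop :=
  forall (o : oracle) (n : nat), approximates o s ->
    exists2 st, exec o alg (initial d n) st & `|r - ratr (st 0%N)| <= 2 ^- n.

Section SpectralNormMax.
Variables (R : realType).
Local Notation C := R[i].

Definition ccont (T : topologicalType) (f : T -> C) :=
  continuous (fun x => complex.Re (f x) : R) /\
  continuous (fun x => complex.Im (f x) : R).

Lemma ccont_cst (T : topologicalType) (c : C) : ccont (fun _ : T => c).
Proof. by split=> x; exact: cvg_cst. Qed.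

Lemma ccontD (T : topologicalType) (f g : T -> C) :
  ccont f -> ccont g -> ccont (fun x => f x + g x).
Proof.
move=> [f1 f2] [g1 g2]; split => x.
  rewrite (_ : (fun _ => _) = (fun x => complex.Re (f x) + complex.Re (g x))).
    by apply: cvgD; [exact: f1|exact: g1].
  by apply/funext => y; case: (f y) (g y) => [? ?] [? ?].
rewrite (_ : (fun _ => _) = (fun x => complex.Im (f x) + complex.Im (g x))).
  by apply: cvgD; [exact: f2|exact: g2].
by apply/funext => y; case: (f y) (g y) => [? ?] [? ?].
Qed.

Lemma ccontM (T : topologicalType) (f g : T -> C) :
  ccont f -> ccont g -> ccont (fun x => f x * g x).
Proof.
move=> [f1 f2] [g1 g2]; split => x.
  rewrite (_ : (fun _ => _) = (fun x => complex.Re (f x) * complex.Re (g x) -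
     complex.Im (f x) * complex.Im (g x))).
    by apply: cvgB; apply: cvgM;
      [exact: f1|exact: g1|exact: f2|exact: g2].
  by apply/funext => y; case: (f y) (g y) => [? ?] [? ?].
rewrite (_ : (fun _ => _) = (fun x => complex.Re (f x) * complex.Im (g x) +
   complex.Im (f x) * complex.Re (g x))).
  by apply: cvgD; apply: cvgM;
    [exact: f1|exact: g2|exact: f2|exact: g1].
by apply/funext => y; case: (f y) (g y) => [? ?] [? ?].
Qed.

Lemma ccont_sum (T : topologicalType) (I : Type) (r : seq I) (f : I -> T -> C) :
  (forall i, ccont (f i)) -> ccont (fun x => \sum_(i <- r) f i x).
Proof.
move=> fc; elim: r => [|i r IH].
  under [X in ccont X]eq_fun do rewrite big_nil; exact: ccont_cst.
under [X in ccont X]eq_fun do rewrite big_cons; exact: ccontD.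
Qed.

Lemma ccont_prod (T : topologicalType) (I : Type) (r : seq I) (f : I -> T -> C) :
  (forall i, ccont (f i)) -> ccont (fun x => \prod_(i <- r) f i x).
Proof.
move=> fc; elim: r => [|i r IH].
  under [X in ccont X]eq_fun do rewrite big_nil; exact: ccont_cst.
under [X in ccont X]eq_fun do rewrite big_cons; exact: ccontM.
Qed.

Lemma normc_sqr (z : C) :
  normc z ^+ 2 = complex.Re z ^+ 2 + complex.Im z ^+ 2.
Proof. by case: z => a b /=; rewrite sqr_sqrtr // addr_ge0 ?sqr_ge0. Qed.

Lemma ccont_normc (T : topologicalType) (f : T -> C) :
  ccont f -> continuous (fun x => normc (f x) : R).
Proof.
move=> [f1 f2] x.
rewrite (_ : (fun _ => _) = Num.sqrt \o
  (fun x => complex.Re (f x) * complex.Re (f x) +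
            complex.Im (f x) * complex.Im (f x))).
  apply: continuous_comp; last exact: sqrt_continuous.
  by apply: cvgD; apply: cvgM;
    [exact: f1|exact: f1|exact: f2|exact: f2].
by apply/funext => y /=; case: (f y) => a b; rewrite /= -!expr2.
Qed.

Let V := 'rV[R]_(2 + 2).

Definition cvec (F : base_field) (v : V) : 'cV[C]_2 :=
  \col_k (v 0 (lshift 2 k) +i*
          (if F is BaseR then 0 else v 0 (rshift 2 k))).

Lemma ccont_cvec F k : ccont (fun v : V => cvec F v k 0).
Proof.
split=> x.
  rewrite (_ : (fun _ => _) = fun v : V => v 0 (lshift 2 k) : R).
    exact: coord_continuous.
  by apply/funext => v; rewrite mxE.
rewrite (_ : (fun _ => _) =
  fun v : V => (if F is BaseR then 0 else v 0 (rshift 2 k)) : R).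
  case: F; last exact: coord_continuous.
  exact: (@cst_continuous V R 0).
by apply/funext => v; rewrite mxE.
Qed.

Lemma in_baseP F (z : C) :
  in_base F z = (if F is BaseR then complex.Im z == 0 else true).
Proof.
case: F => //=; apply/idP/idP => [/complex_realP[a ->] //=|].
by case: z => a b /= /eqP ->; apply/complex_realP; exists a.
Qed.

Lemma in_base_cvec F v k : in_base F (cvec F v k 0).
Proof. by rewrite in_baseP; case: F; rewrite // mxE. Qed.

Lemma cvec_ex F (x : 'cV[C]_2) : (forall k, in_base F (x k 0)) ->
  cvec F (row_mx (\row_k complex.Re (x k 0)) (\row_k complex.Im (x k 0))) = x.
Proof.
move=> xF; apply/colP => k; rewrite mxE row_mxEl row_mxEr !mxE.
by case: F xF => [/(_ k)|_]; rewrite ?in_baseP; case: (x k 0) => a b //= /eqP ->.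
Qed.

Lemma l2norm1 (x : 'cV[C]_2) :
  l2norm x = 1 <-> \sum_(k < 2) normc (x k 0) ^+ 2 = 1.
Proof.
rewrite /l2norm; split=> [h|->]; last by rewrite sqrtr1.
rewrite -[LHS]sqr_sqrtr ?h ?expr1n // sumr_ge0 // => k _.
by rewrite sqr_ge0.
Qed.

Lemma normc_coord_le1 (x : 'cV[C]_2) k : l2norm x = 1 ->
  `|complex.Re (x k 0)| <= 1 /\ `|complex.Im (x k 0)| <= 1.
Proof.
move=> /l2norm1 h.
have : normc (x k 0) ^+ 2 <= 1.
  rewrite -h (bigD1 k) //= lerDl sumr_ge0 // => j _; exact: sqr_ge0.
rewrite normc_sqr => le1.
have sq a : a ^+ 2 <= 1 -> `|a| <= 1 :> R.
  by move=> a1; rewrite -(@ler_pXn2r _ 2) ?nnegrE // expr1n real_normK ?num_real.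
split; apply: sq; apply: le_trans le1.
  by rewrite lerDl sqr_ge0.
by rewrite lerDr sqr_ge0.
Qed.

Let K F : set V := [set v | l2norm (cvec F v) = 1 /\ forall i, `|v 0 i| <= 1].

Lemma continuous_sphere F :
  continuous (fun v : V => \sum_(k < 2) normc (cvec F v k 0) ^+ 2 : R).
Proof.
have c k : continuous (fun v : V => normc (cvec F v k 0) : R).
  exact: ccont_normc (ccont_cvec F k).
have cM k : continuous (fun v : V => normc (cvec F v k 0) * normc (cvec F v k 0)).
  by move=> v; exact: cvgM (c k v) (c k v).
move=> x.
rewrite (_ : (fun _ => _) = fun v : V =>
   normc (cvec F v 0 0) * normc (cvec F v 0 0) +
   normc (cvec F v (lift 0 0) 0) * normc (cvec F v (lift 0 0) 0)).
  exact: cvgD (cM 0 x) (cM _ x).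
by apply/funext => v; rewrite big_ord_recl big_ord1 !expr2.
Qed.

Lemma compact_K F : compact (K F).
Proof.
have cB : compact [set v : V | forall i, v ord0 i \in `[(-1 : R), 1]].
  have h := @rV_compact R (2 + 2) (fun=> `[(-1 : R), 1]%classic)
    (fun=> @segment_compact R (-1) 1).
  by move: h; congr compact; apply/funext => v.
have -> : K F = [set v : V | forall i, v ord0 i \in `[(-1 : R), 1]] `&`
    ((fun v : V => \sum_(k < 2) normc (cvec F v k 0) ^+ 2 : R) @^-1` [set 1]).
  apply/seteqP; split=> v /=.
    by move=> [/l2norm1 h1 h]; split => // i; rewrite in_itv /= -ler_norml.
  move=> [h /l2norm1 h1]; split => // i.
  by have := h i; rewrite in_itv /= -ler_norml.
apply: compact_closedI => //.
by apply: preimage_closed => [v _|]; [exact: continuous_sphere|exact: closed_eq].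
Qed.

Lemma spectral_norm_max (d : nat) (F : base_field) (S : tensor R d) :
  is_maximum (spectral_values F S) (spectral_norm F S).
Proof.
pose f (v : V) : R := normc (tensor_eval S (cvec F v)).
have fc : continuous f.
  apply: ccont_normc; apply: ccont_sum => i; apply: ccontM; first exact: ccont_cst.
  by apply: ccont_prod => k; exact: ccont_cvec.
have valE : spectral_values F S = f @` K F.
  apply/seteqP; split=> r /=.
    move=> [x [xF x1] <-].
    exists (row_mx (\row_k complex.Re (x k 0)) (\row_k complex.Im (x k 0))).
      split; first by rewrite cvec_ex.
      move=> i; case: (split_ordP i) => j ->.
        by rewrite row_mxEl mxE; case: (normc_coord_le1 j x1).
      by rewrite row_mxEr mxE; case: (normc_coord_le1 j x1).
    by rewrite /f cvec_ex.
  move=> [v [v1 _] <-]; exists (cvec F v) => //; split => // k.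
  exact: in_base_cvec.
have K0 : K F !=set0.
  pose x : 'cV[C]_2 := \col_k (if k == 0 then 1 else 0).
  have xF k : in_base F (x k 0).
    by rewrite in_baseP mxE; case: ifP; case: (F).
  have x1 : l2norm x = 1.
    by apply/l2norm1; rewrite big_ord_recl big_ord1 !mxE /= !expr0n /=
      addr0 expr1n addr0 sqrtr1 expr1n sqrtr0 expr0n addr0.
  have [r []] : spectral_values F S !=set0.
    by exists (normc (tensor_eval S x)), x.
  move=> y [yF y1] _.
  have : spectral_values F S (normc (tensor_eval S y)) by exists y.
  by rewrite valE => -[v Kv _]; exists v.
have [v /set_mem Kv vmax] :=
  compact_EVT_max K0 (@compact_K F) (continuous_subspaceT fc).
have vM : is_maximum (spectral_values F S) (f v).
  rewrite valE; split; first by exists v.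
  by move=> _ [w Kw <-]; apply: vmax; rewrite inE.
suff -> : spectral_norm F S = f v by [].
case: vM => vin vub; apply/eqP; rewrite eq_le; apply/andP; split.
  by apply: ge_sup; [exists (f v)|].
by apply: ub_le_sup => //; exists (f v).
Qed.

End SpectralNormMax.

(* Main.v *)
Require Import Defs.
From mathcomp Require Import all_boot all_order all_algebra all_fingroup.
From mathcomp Require Import all_classical all_reals all_analysis.
From mathcomp Require Import complex ring lra.

Set Implicit Arguments.
Unset Strict Implicit.
Unset Printing Implicit Defensive.

Import Order.TTheory GRing.Theory Num.Theory ComplexField.Normc.
Local Open Scope classical_set_scope.
Local Open Scope complex_scope.
Local Open Scope ring_scope.

(** Write f for the binary form of S, so that f (1, z) is phi z and f (0, 1) is
    s_d.  By homogeneity the values of |f| on the unit sphere of F^2 are |s_d|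
    and the numbers |phi z| / (1 + |z|^2)^(d/2) for z in F
    ([spectral_valuesE]), and the spectral norm is their maximum.  Everything
    else rests on the two identities phi = q + z p and phi' = d p.

    Maxima.  If the maximum is reached at z, then the derivative of
    |phi|^2 / (1 + |z|^2)^d vanishes there in every direction available in F,
    and the two identities turn this into p z = conj z * q z
    ([critical_point_complex], [critical_point_real]).  Over the reals this says
    that z is a root of z q - p.  Over the complex numbers put
    J z = conj (p z / q z), so that J z = z.  Up to a power of q z, the pair
    (u z, v z) consists of the conjugates of p and q at J z, so z v - u vanishes
    at z when J (J z) = z ([horner_u], [horner_v]), in particular at every fixed
    point of J.

    When z v - u is zero.  By the same remark this means that J is an involution
    ([fixed_polyP]).  Then the fraction p / q has a left inverse; a fraction
    whose generic fibres have only one point has degree at most one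
    ([left_invertible_fraction]).  As phi' / phi = d p / (q + z p), the
    polynomial phi has at most two roots on the Riemann sphere, infinity
    included ([two_root_factorization]).  For such a phi the fraction p / q is a
    Moebius map, and comparing coefficients in J (J z) = z leaves exactly the
    pairs of antipodal roots: 0 and infinity, or -a and -b with a conj b = -1
    ([conj_involutive_forms]).

    When z q - p is zero, phi solves (1 + z^2) phi' = d z phi, which divides phi
    by 1 + z^2 again and again ([sphere_ode]).  The norm of a monomial is an
    instance of the weighted inequality between arithmetic and geometric means
    ([weighted_AMGM]).

    Computability rests on a grid search.  Multiplying x
    by a complex number of modulus one changes the phase of f x at will, so the
    norm is the maximum of the real part of f on the unit ball of C^2 = R^4.
    The form f is Lipschitz there with a constant that a program can bound, so
    the largest value over the points of a fine rational grid inside the open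
    ball, computed from approximations of the coefficients, is close to the norm
    ([spectral_norm_computed]). *)

(** * Fractions with a left inverse *)

(** The nonroot is a natural number so that it is available in every subfield, in
    particular among the real elements of an algebraically closed field. *)
Lemma exists_nat_nonroot (K : numDomainType) (P : {poly K}) :
  P != 0 -> exists n : nat, P.[n%:R] != 0.
Proof.
move=> P0; pose s : seq K := [seq n%:R | n <- iota 0 (size P)].
have : ~~ all (root P) s.
  apply/negP => sP.
  have us : uniq s.
    by rewrite map_inj_uniq ?iota_uniq // => m n /eqP; rewrite eqr_nat => /eqP.
  by have := max_poly_roots P0 sP us; rewrite size_map size_iota ltnn.
by rewrite -has_predC => /hasP[_ /mapP[n _ ->] nP]; exists n.
Qed.

Lemma exists_notin (K : numDomainType) (E : seq K) : exists x, x \notin E.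
Proof.
have P0 : \prod_(x <- E) ('X - x%:P) != 0 by rewrite monic_neq0 ?monic_prod_XsubC.
have [n] := exists_nat_nonroot P0.
by rewrite -/(root _ _) root_prod_XsubC => nE; exists n%:R.
Qed.

Lemma poly_eq0_generic (K : numDomainType) (b P : {poly K}) :
  b != 0 -> (forall z, b.[z] != 0 -> P.[z] = 0) -> P = 0.
Proof.
move=> b0 bP; apply/eqP; apply: contraT => P0.
have [n] := exists_nat_nonroot (mulf_neq0 b0 P0).
by rewrite hornerM mulf_eq0 negb_or => /andP[/bP ->]; rewrite eqxx.
Qed.

Lemma deriv0_size1 (K : numDomainType) (p : {poly K}) : p^`() = 0 -> (size p <= 1)%N.
Proof.
move=> p'0; apply/leq_sizeP => -[|j] // _; apply/eqP.
have := congr1 (fun r : {poly K} => r`_j) p'0; rewrite coef_deriv coef0 => /eqP.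
by rewrite mulrn_eq0.
Qed.

(** Over an algebraically closed field such a P is a multiple of a power of X - c,
    and the power is at most one because c is not a root of the derivative. *)
Lemma size_le2_roots (K : numClosedFieldType) (P : {poly K}) (c : K) :
  P != 0 -> (forall z, root P z -> z = c /\ P^`().[z] != 0) -> (size P <= 2)%N.
Proof.
move=> P0 Pr; have [rs Prs] := closed_field_poly_normal P.
have lP : lead_coef P != 0 by rewrite lead_coef_eq0.
have rsc : rs = nseq (size rs) c.
  apply/all_pred1P/allP => z zrs; apply/eqP; apply: (Pr z _).1.
  by rewrite Prs rootZ // root_prod_XsubC.
have PE : P = lead_coef P *: ('X - c%:P) ^+ size rs.
  by rewrite {1}Prs rsc big_nseq -Monoid.iteropE size_nseq.
have sP : size P = (size rs).+1.
  by rewrite PE size_scale // size_exp_XsubC.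
rewrite sP; case: (size rs) PE => [|[|n]] // PE.
have rc : root P c by rewrite PE rootZ // exprS rootM root_XsubC eqxx.
have [_ /eqP[]] := Pr c rc.
rewrite PE derivZ deriv_exp hornerZ hornerMn hornerM horner_exp hornerXsubC.
by rewrite subrr exprS mul0r mulr0 mul0rn mulr0.
Qed.

(** A fraction in lowest terms with zero derivative is constant: each of p, q divides
    its own derivative, which has smaller degree. *)
Lemma reduced_Wronskian_eq0 (K : numFieldType) (p q : {poly K}) :
  coprimep p q -> p^`() * q = p * q^`() -> (size p <= 1)%N /\ (size q <= 1)%N.
Proof.
move=> cpq W0.
have dvd0 (r : {poly K}) : r %| r^`() -> r^`() = 0.
  move=> rr'; apply/eqP; apply: contraT => r'0.
  have r0 : r != 0 by apply: contraNneq r'0 => ->; rewrite deriv0.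
  by have := dvdp_leq r'0 rr'; rewrite leqNgt lt_size_deriv.
split; apply/deriv0_size1/dvd0.
  by rewrite -(Gauss_dvdpl _ cpq) W0 dvdp_mulr.
by rewrite -(@Gauss_dvdpr _ _ p q) 1?coprimep_sym // -W0 dvdp_mull.
Qed.

(** The fibres of p / q over all but finitely many values have only one point.  Away
    from the zeros of the Wronskian the fibres consist of simple points, so their
    common number of points, one, bounds the degree of p1 / q1.  Allowing a finite
    set of bad values lets h be a fraction itself. *)
Lemma left_invertible_fraction (K : numClosedFieldType) (p q : {poly K})
    (h : K -> K) (bad : seq K) :
  q != 0 ->
  (forall z, q.[z] != 0 -> p.[z] / q.[z] \notin bad -> z = h (p.[z] / q.[z])) ->
  exists g p1 q1 : {poly K},
    [/\ p = g * p1, q = g * q1, (size p1 <= 2)%N & (size q1 <= 2)%N].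
Proof.
move=> q0 hE; pose g := gcdp p q; pose p1 := p %/ g; pose q1 := q %/ g.
have pE : p = g * p1 by rewrite mulrC divpK // dvdp_gcdl.
have qE : q = g * q1 by rewrite mulrC divpK // dvdp_gcdr.
have cpq : coprimep p1 q1 by apply: coprimep_div_gcd; rewrite q0 orbT.
have /andP[g0 q10] : (g != 0) && (q1 != 0) by rewrite -negb_or -mulf_eq0 -qE.
exists g, p1, q1.
pose W := p1^`() * q1 - p1 * q1^`().
have [/eqP|W0] := eqVneq W 0.
  rewrite subr_eq0 => /eqP /(reduced_Wronskian_eq0 cpq)[sp sq].
  by split=> //; apply: leqW.
have [rs gWE] := closed_field_poly_normal (g * W).
have rsP z : root (g * W) z = (z \in rs).
  by rewrite gWE rootZ ?lead_coef_eq0 ?mulf_neq0 // root_prod_XsubC.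
(* The values taken where the common factor vanishes or where the fibre is not
   simple are avoided. *)
pose E := bad ++ [seq p1.[z] / q1.[z] | z <- rs].
have sizeE b : b \notin E -> (size (p1 - b *: q1)%R <= 2)%N.
  rewrite mem_cat negb_or => /andP[bbad bE].
  apply: (@size_le2_roots _ _ (h b)).
    apply: contraNneq W0 => /eqP; rewrite subr_eq0 => /eqP p1E.
    by rewrite /W p1E derivZ -!scalerAl mulrC subrr.
  move=> z; rewrite /root !hornerE subr_eq0 => /eqP p1z.
  have q1z : q1.[z] != 0.
    apply/negP => /eqP q1z; have := coprimep_root cpq (x := z).
    by rewrite /root p1z q1z mulr0 eqxx => /(_ isT) /eqP.
  have bq : p1.[z] / q1.[z] = b by rewrite p1z mulfK.
  have : z \notin rs by apply: contra bE => zrs; apply/mapP; exists z.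
  rewrite -rsP rootM negb_or => /andP[gz Wz].
  have qz : q.[z] != 0 by rewrite qE hornerM mulf_neq0.
  have pq : p.[z] / q.[z] = b.
    by rewrite pE qE !hornerM -mulf_div divff // mul1r.
  split; first by rewrite [LHS]hE // pq.
  apply: contra Wz; rewrite derivB derivZ /root /W !hornerE p1z => /eqP e.
  by rewrite mulrAC -mulrBl e mul0r.
have [b bE] := exists_notin E; have [b'] := exists_notin (b :: E).
rewrite inE negb_or => /andP[bb' b'E].
have sq1 : (size q1 <= 2)%N.
  have -> : q1 = (b' - b)^-1 *: ((p1 - b *: q1) - (p1 - b' *: q1)).
    have -> : p1 - b *: q1 - (p1 - b' *: q1) = (b' - b) *: q1.
      by rewrite opprB addrC addrA subrK scalerBl.
    by rewrite scalerA mulVf ?scale1r // subr_eq0.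
  apply: leq_trans (size_scale_leq _ _) _; apply: leq_trans (size_polyD _ _) _.
  by rewrite size_polyN geq_max !sizeE.
split=> //; rewrite -(subrK (b *: q1) p1).
apply: leq_trans (size_polyD _ _) _; rewrite geq_max sizeE //=.
exact: leq_trans (size_scale_leq _ _) sq1.
Qed.

(** * Polynomials with a logarithmic derivative of small degree *)

(** If f vanished at z to order m and Q did not vanish there, the left-hand side would
    vanish to order m - 1 only. *)
Lemma root_of_cofactor (K : numFieldType) (f Q L : {poly K}) (z : K) :
  f != 0 -> f^`() * Q = f * L -> root f z -> root Q z.
Proof.
move=> f0; have [[|m] [h]] := multiplicity_XsubC f z.
  by rewrite f0 expr0 mulr1 => /= hz ->; rewrite (negPf hz).
rewrite f0 /= => hz fE e _.
have e2 : (h^`() * ('X - z%:P) + h *+ m.+1) * Q = h * ('X - z%:P) * L.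
  apply: (@mulfI _ (('X - z%:P) ^+ m)).
    by rewrite expf_neq0 // polyXsubC_eq0.
  have -> : ('X - z%:P) ^+ m * (h * ('X - z%:P) * L) = f * L.
    by rewrite fE exprS; ring.
  rewrite -e fE derivM deriv_exp derivXsubC mul1r /= exprS.
  by rewrite -mulr_natr -[h *+ _]mulr_natr; ring.
have := congr1 (fun r : {poly K} => r.[z]) e2.
rewrite !hornerM hornerD hornerM hornerMn hornerXsubC subrr !(mulr0, mul0r) add0r.
by move/eqP; rewrite mulf_eq0 mulrn_eq0 /= -/(root h z) (negPf hz) /=.
Qed.

Lemma lead_coef_deriv (K : numDomainType) (f : {poly K}) :
  lead_coef f^`() = lead_coef f *+ (size f).-1.
Proof.
have [sf|sf] := leqP (size f) 1.
  have -> : f^`() = 0 by rewrite (size1_polyC sf) derivC.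
  by rewrite lead_coef0; case: (size f) sf => [|[]].
have f'E : f^`()`_(size f).-2 = lead_coef f *+ (size f).-1.
  by rewrite coef_deriv lead_coefE -[in LHS]subn2 -[(size f).-1]subn1 -subSn.
suff sf' : size f^`() = (size f).-1 by rewrite lead_coefE sf' f'E.
have f0 : f != 0 by rewrite -size_poly_gt0 ltnW.
apply/eqP; rewrite eqn_leq -ltnS prednK ?size_poly_gt0 // lt_size_deriv //=.
rewrite -[X in (X <= _)%N]prednK ?ltn_predRL // ltnNge; apply/negP => le.
have := leq_sizeP _ _ le _ (leqnn _).
by move/eqP; rewrite f'E mulrn_eq0 lead_coef_eq0 (negPf f0) -leqn0 leqNgt ltn_predRL sf.
Qed.

Lemma prod_XsubC_nseq (K : comNzRingType) (rs : seq K) (a : K) :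
  all (pred1 a) rs -> \prod_(z <- rs) ('X - z%:P) = ('X - a%:P) ^+ size rs.
Proof.
elim: rs => [|x rs IH] /=; first by rewrite big_nil.
by case/andP=> /eqP -> /IH E; rewrite big_cons E exprS.
Qed.


Lemma prod_XsubC_count (K : comNzRingType) (rs : seq K) (a b : K) :
  a != b -> all (pred2 a b) rs ->
  \prod_(z <- rs) ('X - z%:P) =
    ('X - a%:P) ^+ count_mem a rs * ('X - b%:P) ^+ count_mem b rs.
Proof.
move=> ab; elim: rs => [|x rs IH] /=; first by rewrite big_nil mulr1.
case/andP=> /orP[] /eqP -> /IH E; rewrite big_cons E !eqxx ?(negPf ab) /=.
  by rewrite add0n exprS mulrA.
by rewrite eq_sym (negPf ab) exprS mulrCA.
Qed.

(** With Q = q + X p of degree at most two, f = g Q and f' Q = d p f, so every root of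
    f is a root of Q.  If there are two distinct ones, then Q has degree two, and the
    leading coefficients in f' Q = d p f give deg f = d: there is no root at infinity. *)
Lemma two_root_factorization (K : numClosedFieldType) (d : nat)
    (f g p q : {poly K}) :
  f != 0 -> (size p <= 2)%N -> (size q <= 2)%N ->
  f^`() = (g * p) *+ d -> f = g * q + 'X * (g * p) ->
  (exists A a k, A != 0 /\ f = A *: ('X + a%:P) ^+ k) \/
  (exists A a b m n, [/\ A != 0, a != b, (0 < m)%N && (0 < n)%N, (m + n = d)%N &
      f = A *: (('X + a%:P) ^+ m * ('X + b%:P) ^+ n)]).
Proof.
move=> f0 sp sq f'E fE; pose Q := q + 'X * p.
have fQ : f = g * Q by rewrite fE /Q; ring.
have ode : f^`() * Q = f * (p *+ d).
  by rewrite f'E fQ mulrnAl mulrnAr; congr (_ *+ _); ring.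
have Q0 : Q != 0 by apply: contraNneq f0 => Q0; rewrite fQ Q0 mulr0.
have sXp : (size ('X * p)%R <= 3)%N.
  by rewrite (leq_trans (size_polyMleq _ _)) // size_polyX.
have sQ : (size Q <= 3)%N.
  by rewrite (leq_trans (size_polyD _ _)) // geq_max (leq_trans sq).
have [rs rsE] := closed_field_poly_normal f.
have A0 : lead_coef f != 0 by rewrite lead_coef_eq0.
have sf : size f = (size rs).+1 by rewrite rsE size_scale // size_prod_XsubC.
have rsQ z : z \in rs -> root Q z.
  move=> zrs; apply: root_of_cofactor f0 ode _.
  by rewrite rsE rootZ // root_prod_XsubC.
case: rs => [|a rs] in rsE sf rsQ *.
  by left; exists (lead_coef f), 0, 0%N; rewrite {2}rsE big_nil expr0.
have [rsa|] := boolP (all (pred1 a) rs).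
  left; exists (lead_coef f), (- a), (size rs).+1; split=> //.
  by rewrite {1}rsE big_cons (prod_XsubC_nseq rsa) polyCN exprS.
rewrite -has_predC => /hasP[b brs /= ba].
have rsab : all (pred2 a b) (a :: rs).
  apply/allP => z zrs /=; apply: contraLR sQ; rewrite negb_or => /andP[za zb].
  rewrite -ltnNge; apply: (@max_poly_roots _ _ [:: z; a; b]) => //=.
    by rewrite !rsQ ?mem_head // inE brs orbT.
  by rewrite !inE negb_or za zb eq_sym ba.
have {}sQ : size Q = 3.
  apply/eqP; rewrite eqn_leq sQ /=.
  apply: (@max_poly_roots _ _ [:: a; b]) => //=.
    by rewrite !rsQ ?mem_head // inE brs orbT.
  by rewrite !inE eq_sym ba.
have lQ : lead_coef Q = lead_coef p.
  have Q2 : Q`_2 = p`_1.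
    by rewrite coefD coefXM /= (leq_sizeP _ _ sq) ?add0r.
  have p1 : p`_1 != 0.
    by move: Q0; rewrite -lead_coef_eq0 lead_coefE sQ Q2.
  rewrite [LHS]lead_coefE sQ Q2 lead_coefE; congr p`_ _.
  suff -> : size p = 2 by [].
  by apply/eqP; rewrite eqn_leq sp ltnNge; apply: contra p1 => /leq_sizeP ->.
have dE : size (a :: rs) = d.
  have := congr1 lead_coef ode.
  rewrite !lead_coefM lead_coef_deriv lQ sf -pred_Sn.
  rewrite (_ : lead_coef (p *+ d) = lead_coef p *+ d); last first.
    by rewrite -!scaler_nat lead_coefZ mulr_natl.
  rewrite mulrnAl -mulrnAr => /(mulfI A0)/eqP; rewrite -subr_eq0.
  have l0 : lead_coef p != 0 by rewrite -lQ lead_coef_eq0.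
  rewrite -[X in _ - X]mulr_natr -[X in X - _]mulr_natr -mulrBr mulf_eq0 (negPf l0).
  by rewrite /= subr_eq0 eqr_nat => /eqP.
right; exists (lead_coef f), (- a), (- b).
exists (count_mem a (a :: rs)), (count_mem b (a :: rs)).
have ab : a != b by rewrite eq_sym.
split=> //; first by rewrite eqr_opp.
- by rewrite -!has_count !has_pred1 mem_head inE brs orbT.
- rewrite -dE -(count_predC (pred1 a) (a :: rs)); congr addn.
  apply: eq_in_count => z /(allP rsab) /=; case: (z =P a) => [->|] //=.
  by rewrite (negPf ab).
by rewrite {1}rsE (prod_XsubC_count ab rsab) !polyCN.
Qed.

(** * Involutions z |-> conj (p z / q z) *)

(** With J z = conj (p z / q z) the condition reads J (J z) = z, cleared of the outer
    denominator so that it also makes sense where q (J z) = 0. *)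
Definition conj_involutive (K : numClosedFieldType) (p q : {poly K}) : Prop :=
  forall z, q.[z] != 0 ->
    let w := (p.[z] / q.[z])^* in z^* * q.[w] = p.[w].

Definition affine (K : nzRingType) (a b : K) : {poly K} := a *: 'X + b%:P.

Lemma horner_affine (K : comNzRingType) (a b z : K) : (affine a b).[z] = a * z + b.
Proof. by rewrite /affine !hornerE. Qed.

Lemma affine_eq0 (K : comNzRingType) (a b : K) :
  (affine a b == 0) = (a == 0) && (b == 0).
Proof.
apply/eqP/andP => [e|[/eqP -> /eqP ->]]; last by rewrite /affine scale0r add0r.
have := congr1 (fun r : {poly K} => r`_1) e; have := congr1 (fun r : {poly K} => r`_0) e.
by rewrite !(coefD, coefZ, coefX, coefC, coef0) /= mulr0 mulr1 add0r addr0 => -> ->.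
Qed.

Section ConjAffine.
Variables (K : numClosedFieldType) (d : nat) (p q : {poly K}).
Variables (A a b a1 b1 a2 b2 : K) (m n : nat).
Hypotheses (d0 : (0 < d)%N) (A0 : A != 0).
Hypothesis pE :
  p *+ d = A *: (('X + a%:P) ^+ m * ('X + b%:P) ^+ n * affine a1 b1).
Hypothesis qE :
  q *+ d = A *: (('X + a%:P) ^+ m * ('X + b%:P) ^+ n * affine a2 b2).

Let G x := A * ((x + a) ^+ m * (x + b) ^+ n).

Let dK : d%:R != 0 :> K. Proof. by rewrite pnatr_eq0 -lt0n. Qed.

Let horner_form r c e x :
    r *+ d = A *: (('X + a%:P) ^+ m * ('X + b%:P) ^+ n * affine c e) ->
  r.[x] * d%:R = G x * (c * x + e).
Proof.
move=> rE; rewrite mulr_natr -hornerMn rE hornerZ !hornerM !horner_exp horner_affine.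
by rewrite !hornerD hornerX !hornerC /G -!mulrA.
Qed.

Let pz x : p.[x] * d%:R = G x * (a1 * x + b1). Proof. exact: horner_form. Qed.

Let qz x : q.[x] * d%:R = G x * (a2 * x + b2). Proof. exact: horner_form. Qed.

Let q_neq0 z : (q.[z] != 0) = (G z != 0) && (a2 * z + b2 != 0).
Proof. by rewrite -(mulIr_eq0 _ (mulIf dK)) qz mulf_eq0 negb_or. Qed.

Let fraction z : q.[z] != 0 -> p.[z] / q.[z] = (a1 * z + b1) / (a2 * z + b2).
Proof.
move=> q0; have /andP[G0 y0] : (G z != 0) && (a2 * z + b2 != 0) by rewrite -q_neq0.
apply/eqP; rewrite eqr_div // -(inj_eq (mulIf dK)); apply/eqP.
have -> : p.[z] * (a2 * z + b2) * d%:R = p.[z] * d%:R * (a2 * z + b2) by ring.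
have -> : (a1 * z + b1) * q.[z] * d%:R = (a1 * z + b1) * (q.[z] * d%:R) by ring.
by rewrite pz qz; ring.
Qed.

Let conj_equation x y z : y != 0 ->
  (z^* * (a2 * (x / y)^* + b2) = a1 * (x / y)^* + b1) <->
  (z * (a2^* * x + b2^* * y) = a1^* * x + b1^* * y).
Proof.
move=> y0; have -> : a2^* * x + b2^* * y = (a2 * (x / y)^* + b2)^* * y.
  by rewrite !(rmorphM, rmorphD) /= !conjCK; field.
have -> : a1^* * x + b1^* * y = (a1 * (x / y)^* + b1)^* * y.
  by rewrite !(rmorphM, rmorphD) /= !conjCK; field.
rewrite mulrA; split=> [<-|]; first by rewrite [(z^* * _)^*]rmorphM /= conjCK.
by move=> /(mulIf y0) e; apply: (can_inj (@conjCK K)); rewrite [(z^* * _)^*]rmorphM /= conjCK.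
Qed.

Lemma conj_involutive_affine :
  (forall z, z * (a2^* * (a1 * z + b1) + b2^* * (a2 * z + b2)) =
             a1^* * (a1 * z + b1) + b1^* * (a2 * z + b2)) ->
  conj_involutive p q.
Proof.
move=> e z q0 /=; rewrite fraction //.
have /andP[G0 y0] : (G z != 0) && (a2 * z + b2 != 0) by rewrite -q_neq0.
apply: (mulIf dK); rewrite -mulrA qz pz mulrCA; congr (_ * _).
exact/conj_equation.
Qed.

(** After removing common factors p / q is the Moebius map with matrix
    N = ((a1, b1), (a2, b2)), and J (J z) = z says that conj N * N is scalar: the three
    equations say so entry by entry.  The nondegeneracy hypotheses say that J is
    undefined, or takes one of the values -a and -b, at which the common factor
    vanishes, only finitely often. *)
Lemma conj_involutive_affine_eq :
  affine a2 b2 != 0 ->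
  affine (a1 + a^* * a2) (b1 + a^* * b2) != 0 ->
  affine (a1 + b^* * a2) (b1 + b^* * b2) != 0 ->
  conj_involutive p q ->
  [/\ a2^* * a1 + b2^* * a2 = 0,
      a2^* * b1 + b2^* * b2 = a1^* * a1 + b1^* * a2 &
      a1^* * b1 + b1^* * b2 = 0].
Proof.
move=> Q0 Qa Qb pq.
pose P := 'X * affine (a2^* * a1 + b2^* * a2) (a2^* * b1 + b2^* * b2) -
  affine (a1^* * a1 + b1^* * a2) (a1^* * b1 + b1^* * b2).
have P0 : P = 0.
  apply: (@poly_eq0_generic _ (q * affine (a1 + a^* * a2) (b1 + a^* * b2) *
      affine (a1 + b^* * a2) (b1 + b^* * b2))).
    rewrite !mulf_neq0 //; apply: contraNneq Q0 => q0.
    move/eqP: qE; rewrite q0 mul0rn eq_sym scaler_eq0 (negPf A0) mulf_eq0.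
    rewrite mulf_eq0 !expf_eq0 -!size_poly_eq0.
    by rewrite !size_XaddC /= !andbF.
  move=> z; rewrite !hornerM !horner_affine !mulf_eq0 !negb_or => /andP[/andP[q0 za] zb].
  have /andP[G0 y0] : (G z != 0) && (a2 * z + b2 != 0) by rewrite -q_neq0.
  have /(congr1 (fun x => x * d%:R)) := pq z q0; rewrite /= fraction // -mulrA qz pz.
  set w := (_ / _)^*.
  have Gw : G w != 0.
    rewrite /G !mulf_neq0 // expf_neq0 // -(inj_eq (can_inj (@conjCK K))) rmorphD /= conjCK rmorph0.
      apply: contra za => /eqP e; rewrite -(mulIr_eq0 _ (mulIf (invr_neq0 y0))).
      by apply/eqP; rewrite -[RHS]e; field.
    apply: contra zb => /eqP e; rewrite -(mulIr_eq0 _ (mulIf (invr_neq0 y0))).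
    by apply/eqP; rewrite -[RHS]e; field.
  rewrite mulrCA => /(mulfI Gw) /conj_equation => /(_ y0) e.
  rewrite /P hornerD hornerN hornerM hornerX !horner_affine; apply/eqP.
  rewrite subr_eq0; apply/eqP; transitivity (z * (a2^* * (a1 * z + b1) + b2^* * (a2 * z + b2))).
    by ring.
  by rewrite e; ring.
have Pc i : P`_i = 0 by rewrite P0 coef0.
move: (Pc 0%N) (Pc 1%N) (Pc 2%N); rewrite !(coefD, coefN, coefXM, coefZ, coefX, coefC) /=.
rewrite !(mulr0, mulr1, addr0, add0r, subr0) => /eqP.
by rewrite oppr_eq0 => /eqP -> /eqP; rewrite subr_eq0 => /eqP -> ->.
Qed.

End ConjAffine.

Section Forms.
Variables (K : numClosedFieldType) (d : nat) (f p q : {poly K}).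
Hypotheses (d0 : (0 < d)%N) (pE : f^`() = p *+ d) (fE : f = q + 'X * p).

Let dK : d%:R != 0 :> K. Proof. by rewrite pnatr_eq0 -lt0n. Qed.

Let polyMn0 (r : {poly K}) : r *+ d = 0 -> r = 0.
Proof. by move/eqP; rewrite -scaler_nat scaler_eq0 (negPf dK) => /eqP. Qed.

Let qE : q *+ d = f *+ d - 'X * f^`().
Proof. by rewrite pE fE mulrnDl mulrnAr addrK. Qed.

Let power_pE A a k : f = A *: ('X + a%:P) ^+ k.+1 ->
  p *+ d = A *: (('X + a%:P) ^+ k * ('X + a%:P) ^+ 0 * affine 0 k.+1%:R).
Proof.
move=> E; rewrite -pE E derivZ deriv_exp derivD derivX derivC addr0 mul1r.
by rewrite /affine scale0r add0r expr0 mulr1 polyC_natr mulr_natr.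
Qed.

Let power_qE A a k : f = A *: ('X + a%:P) ^+ k.+1 ->
  q *+ d = A *: (('X + a%:P) ^+ k * ('X + a%:P) ^+ 0 *
                 affine (d%:R - k.+1%:R) (d%:R * a)).
Proof.
move=> E; rewrite qE pE (power_pE E) E /affine -!mul_polyC -mulr_natr.
by rewrite !(polyCD, polyCM, polyCN, polyC_natr) polyC0 expr0 exprS; ring.
Qed.

Let two_pE A a b m n : f = A *: (('X + a%:P) ^+ m.+1 * ('X + b%:P) ^+ n.+1) ->
    (m.+1 + n.+1 = d)%N ->
  p *+ d = A *: (('X + a%:P) ^+ m * ('X + b%:P) ^+ n *
                 affine d%:R (m.+1%:R * b + n.+1%:R * a)).
Proof.
move=> E dE; rewrite -pE E derivZ derivM !deriv_exp !derivD !derivX !derivC !addr0 !mul1r.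
rewrite /= !exprS /affine -!mul_polyC -dE natrD.
rewrite -[_ ^+ m *+ _]mulr_natr -[_ ^+ n *+ _]mulr_natr.
by rewrite !(polyCD, polyCM, polyCN, polyC_natr); ring.
Qed.

Let two_qE A a b m n : f = A *: (('X + a%:P) ^+ m.+1 * ('X + b%:P) ^+ n.+1) ->
    (m.+1 + n.+1 = d)%N ->
  q *+ d = A *: (('X + a%:P) ^+ m * ('X + b%:P) ^+ n *
                 affine (m.+1%:R * a + n.+1%:R * b) (d%:R * (a * b))).
Proof.
move=> E dE; rewrite qE pE (two_pE E dE) E /affine -!mul_polyC -mulr_natr.
by rewrite !exprS -dE natrD !(polyCD, polyCM, polyCN, polyC_natr); ring.
Qed.

(** The only root -a is antipodal to infinity, that is a = 0; for k = 0 or k = d the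
    map J would be constant or undefined. *)
Lemma power_conj_involutive A a k : A != 0 -> f = A *: ('X + a%:P) ^+ k ->
  q != 0 -> (k <= d)%N -> conj_involutive p q -> (0 < k < d)%N /\ a = 0.
Proof.
move=> A0; case: k => [|k] E q0 kd pq.
  have p0 : p = 0.
    by apply: polyMn0; rewrite -pE E derivZ expr0 -polyC1 derivC scaler0.
  have qA : q = A%:P by rewrite -alg_polyC -[q]addr0 -(mulr0 'X) -p0 -fE E expr0.
  have := pq 1; rewrite qA p0 hornerC => /(_ A0) /=; rewrite !hornerC conjC1 mul1r => /eqP.
  by rewrite (negPf A0).
have Q0 : affine (d%:R - k.+1%:R) (d%:R * a) != 0 :> {poly K}.
  apply: contraNneq q0 => Q0; apply/eqP/polyMn0.
  by rewrite (power_qE E) Q0 mulr0 scaler0.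
have Qa : affine (0 + a^* * (d%:R - k.+1%:R)) (k.+1%:R + a^* * (d%:R * a)) != 0 :> {poly K}.
  rewrite affine_eq0 negb_and orbC gt_eqF // ltr_wpDr ?ltr0Sn //.
  by rewrite mulrCA mulr_ge0 // mulrC mul_conjC_ge0.
have [_ _] := conj_involutive_affine_eq d0 A0 (power_pE E) (power_qE E) Q0 Qa Qa pq.
rewrite conjC0 mul0r add0r conjC_nat => /eqP.
rewrite !mulf_eq0 pnatr_eq0 (negPf dK) /= => /eqP a0; split=> //.
rewrite ltn_neqAle kd andbT; apply: contraNneq Q0 => kdE.
by rewrite a0 mulr0 kdE subrr affine_eq0 eqxx.
Qed.

(** With w = 1 + a conj b, the off-diagonal entries of conj N * N form a linear system
    for w and conj w.  If w were nonzero, the system would force m = n, |a| = |b| and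
    then b = - a, and the diagonal entries would give |a| = 1; but then w = 0. *)
Lemma two_root_conj_involutive A a b m n : A != 0 -> a != b ->
    (0 < m)%N -> (0 < n)%N -> (m + n = d)%N ->
    f = A *: (('X + a%:P) ^+ m * ('X + b%:P) ^+ n) ->
  conj_involutive p q -> a * b^* = -1.
Proof.
move=> A0 ab; case: m n => // m [] // n _ _ dE E pq.
have mK i : i.+1%:R != 0 :> K by rewrite pnatr_eq0.
have d_eq : d%:R = m.+1%:R + n.+1%:R :> K by rewrite -dE natrD.
set M : K := m.+1%:R in d_eq *; set N : K := n.+1%:R in d_eq *.
set al := M * a + N * b; set be := M * b + N * a.
(* The Moebius map is invertible because the two roots are distinct. *)
have det0 : d%:R * (d%:R * (a * b)) - be * al != 0.
  have -> : d%:R * (d%:R * (a * b)) - be * al = - (M * N * (a - b) ^+ 2).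
    by rewrite d_eq /al /be; ring.
  by rewrite oppr_eq0 mulf_neq0 ?mulf_neq0 ?expf_neq0 ?mK // subr_eq0.
have nondeg x : affine (d%:R + x * al) (be + x * (d%:R * (a * b))) != 0 :> {poly K}.
  apply: contra det0; rewrite affine_eq0 => /andP[/eqP e1 /eqP e2]; apply/eqP.
  transitivity (d%:R * (a * b) * (d%:R + x * al) - al * (be + x * (d%:R * (a * b)))).
    by ring.
  by rewrite e1 e2; ring.
have Q0 : affine al (d%:R * (a * b)) != 0 :> {poly K}.
  apply: contra det0; rewrite affine_eq0 => /andP[/eqP -> /eqP ->].
  by rewrite !mulr0 subrr.
have [] := conj_involutive_affine_eq d0 A0 (two_pE E dE) (two_qE E dE) Q0
  (nondeg _) (nondeg _) pq.
rewrite -/M -/N -/al -/be !rmorphM !conjC_nat /= => e2 e1 e0.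
pose w := 1 + a * b^*; pose w' := 1 + b * a^*.
have [/eqP|w0] := eqVneq w 0; first by rewrite /w addrC addr_eq0 => /eqP.
have w'E : w' = w^* by rewrite /w' /w rmorphD rmorphM /= conjC1 conjCK mulrC.
have alc : al^* = M * a^* + N * b^* by rewrite rmorphD !rmorphM /= !conjC_nat.
have bec : be^* = M * b^* + N * a^* by rewrite rmorphD !rmorphM /= !conjC_nat.
have E2 : M * a^* * w + N * b^* * w' = 0.
  by apply: (mulfI dK); rewrite mulr0 -[RHS]e2 alc /w /w' /al; ring.
have E0 : M * b * w + N * a * w' = 0.
  by apply: (mulfI dK); rewrite mulr0 -[RHS]e0 bec /w /w' /be; ring.
have E2' : M * a * w' + N * b * w = 0.
  have cj x y : (M * a^* * x + N * b^* * y)^* = M * a * x^* + N * b * y^*.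
    by rewrite rmorphD !rmorphM /= !conjC_nat !conjCK.
  by rewrite -[RHS](conjC0 K) -E2 cj w'E conjCK.
have ab_norm : a * a^* = b * b^*.
  have : M * N * w * (a * a^* - b * b^*) = 0.
    transitivity (N * a * (M * a^* * w + N * b^* * w') - N * b^* * (M * b * w + N * a * w')).
      by ring.
    by rewrite E2 E0; ring.
  by move/eqP; rewrite !mulf_eq0 !(negPf (mK _)) (negPf w0) /= subr_eq0 => /eqP.
have ab0 : a * b != 0.
  have a0_b0 : (a == 0) = (b == 0) by rewrite -(mul_conjC_eq0 a) ab_norm mul_conjC_eq0.
  by apply: contra ab; rewrite mulf_eq0 a0_b0 orbb => b0; rewrite (eqP b0) a0_b0.
have MN : M = N.
  have : w * (a * b) * (M - N) * (M + N) = 0.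
    transitivity (M * a * (M * b * w + N * a * w') - N * a * (M * a * w' + N * b * w)).
      by ring.
    by rewrite E2' E0; ring.
  move/eqP; rewrite !mulf_eq0 -d_eq (negPf dK) (negPf w0) -mulf_eq0 (negPf ab0) /= orbF.
  by rewrite subr_eq0 => /eqP.
have ba : b = - a.
  have : M * ((a + b) * (1 + a * a^*)) = 0.
    transitivity (M * b * w + N * a * w'); last exact: E0.
    rewrite -MN /w /w'; transitivity (M * (a + b + a * (b * b^*) + b * (a * a^*))); last by ring.
    by rewrite -ab_norm; ring.
  move/eqP; rewrite !mulf_eq0 (negPf (mK _)) /= (gt_eqF (ltr_pwDl ltr01 (mul_conjC_ge0 a))) orbF.
  by rewrite addr_eq0 => /eqP ->; rewrite opprK.
have al0 : al = 0 by rewrite /al -MN ba; ring.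
have be0 : be = 0 by rewrite /be -MN ba; ring.
have aa1 : (a * a^* - 1) * (a * a^* + 1) = 0.
  apply: (mulfI (mulf_neq0 dK dK)); rewrite mulr0 mulrDr.
  move/eqP: e1; rewrite al0 be0 !conjC0 !mul0r add0r addr0 -subr_eq0 => /eqP <-.
  by rewrite ba rmorphN; ring.
move/eqP: aa1; rewrite mulf_eq0 [_ + 1]addrC (gt_eqF (ltr_pwDl ltr01 (mul_conjC_ge0 a))) orbF.
by rewrite subr_eq0 ba rmorphN mulrN => /eqP ->.
Qed.

Lemma monomial_conj_involutive A k : A != 0 -> (0 < k < d)%N -> f = A *: 'X^k ->
  q != 0 /\ conj_involutive p q.
Proof.
case: k => // k A0 /andP[_ kd] E.
have {}E : f = A *: ('X + 0%:P) ^+ k.+1 by rewrite addr0.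
have dk0 : d%:R - k.+1%:R != 0 :> K by rewrite subr_eq0 eqr_nat gtn_eqF.
split.
  apply: contraNneq A0 => q0; move/eqP: (power_qE E).
  rewrite q0 mul0rn eq_sym scaler_eq0 mulf_eq0 affine_eq0 (negPf dk0) orbF.
  by rewrite addr0 expr0 mulr1 expf_eq0 polyX_eq0 andbF orbF.
apply: conj_involutive_affine d0 (power_pE E) (power_qE E) _ => z.
by rewrite !(rmorphB, rmorphM) /= !conjC_nat !conjC0; ring.
Qed.

Lemma antipodal_conj_involutive A a b m : A != 0 -> (0 < m < d)%N -> a * b^* = -1 ->
    f = A *: (('X + a%:P) ^+ m * ('X + b%:P) ^+ (d - m)) ->
  q != 0 /\ conj_involutive p q.
Proof.
move=> A0 /andP[m0 md] ab E.
have [n dE] : exists n, (m + n.+1 = d)%N.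
  by exists (d - m).-1; rewrite prednK ?subn_gt0 // subnKC // ltnW.
move: E; rewrite -{1}dE addKn; case: m => // m in m0 md dE * => E.
have ba : b * a^* = -1.
  by rewrite -[LHS]conjCK rmorphM /= conjCK mulrC ab rmorphN /= conjC1.
split.
  apply: contraNneq A0 => q0; move/eqP: (two_qE E dE).
  rewrite q0 mul0rn eq_sym scaler_eq0 !mulf_eq0 affine_eq0 !expf_eq0.
  rewrite -!size_poly_eq0 !size_XaddC !andbF /= mulf_eq0 (negPf dK) /=.
  case/orP=> // /andP[_]; rewrite mulf_eq0 => /orP[] /eqP x0.
    by move/eqP: ab; rewrite x0 mul0r eq_sym oppr_eq0 oner_eq0.
  by move/eqP: ba; rewrite x0 mul0r eq_sym oppr_eq0 oner_eq0.
apply: conj_involutive_affine d0 (two_pE E dE) (two_qE E dE) _ => z.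
have d_eq : d%:R = m.+1%:R + n.+1%:R :> K by rewrite -dE natrD.
rewrite !(rmorphD, rmorphM) /= !conjC_nat d_eq; ring: ab ba.
Qed.

Lemma conj_involutive_forms : f != 0 -> (size f <= d.+1)%N -> q != 0 ->
  conj_involutive p q ->
  (exists A k, [/\ A != 0, (0 < k < d)%N & f = A *: 'X^k]) \/
  (exists A a b m, [/\ A != 0, (0 < m < d)%N, a * b^* = -1 &
      f = A *: (('X + a%:P) ^+ m * ('X + b%:P) ^+ (d - m))]).
Proof.
move=> f0 sf q0 pq.
have [rs rsE] := closed_field_poly_normal q.
have rsP z : root q z = (z \in rs).
  by rewrite {1}rsE rootZ ?lead_coef_eq0 // root_prod_XsubC.
have [||g [p1 [q1 [pg qg sp sq]]]] := @left_invertible_fraction _ p q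
    (fun x => (p.[x^*] / q.[x^*])^* ) [seq x^* | x <- rs] => //.
  move=> z qz bad; rewrite -(pq z qz) mulfK ?conjCK //.
  apply: contra bad => qw; apply/mapP; exists (p.[z] / q.[z])^*; last by rewrite conjCK.
  by rewrite -rsP.
have [||[A [a [k [A0 E]]]]|[A [a [b [m [n [A0 ab /andP[m0 n0] mn E]]]]]]] :=
    @two_root_factorization _ d f g p1 q1 f0 sp sq.
- by rewrite pE pg.
- by rewrite {1}fE pg qg.
- left; have kd : (k <= d)%N.
    by move: sf; rewrite E size_scale // -ltnS -(opprK a) polyCN size_exp_XsubC.
  have [k0 a0] := power_conj_involutive A0 E q0 kd pq.
  by exists A, k; rewrite E a0 addr0.
- right; exists A, a, b, m; rewrite -{2}mn addKn; split=> //.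
    by rewrite m0 -mn -[X in (X < _)%N]addn0 ltn_add2l.
  exact: two_root_conj_involutive A0 ab m0 n0 mn E pq.
Qed.

End Forms.

(** * Critical points and the equation of the sphere *)

(** A polynomial that is nonnegative on the real line and vanishes at 0 has a minimum
    there.  The argument is algebraic so that it applies to polynomials with complex
    coefficients that are real on the real line. *)
Lemma poly_min_coef1 (K : numFieldType) (H : {poly K}) :
  (forall t, t \is Num.real -> 0 <= H.[t]) -> H.[0] = 0 -> H`_1 = 0.
Proof.
move=> H_ge0 H0.
have [G HE] : exists G, H = G * 'X.
  by have /factor_theorem[G ->] : root H 0; [exact/eqP | exists G; rewrite subr0].
have [L GE] : exists L, G = L * 'X + (G`_0)%:P.
  have /factor_theorem[L LE] : root (G - (G`_0)%:P) 0.
    by rewrite /root hornerD hornerN hornerC horner_coef0 subrr.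
  by exists L; rewrite -(subr0 'X) -LE subrK.
have -> : H`_1 = G`_0 by rewrite HE coefMX.
set g := G`_0 in GE *; apply/eqP; apply: contraT => g0.
have [B LB] := poly_disk_bound L 1.
have B0 : 0 <= B by apply: le_trans (LB 0 _); rewrite ?normr0.
have ng : 0 < `|g| by rewrite normr_gt0.
(* H / t is nonnegative at e and nonpositive at - e, and both values are within e B
   of g; hence |g| <= 3 B e, against the choice of e. *)
pose e := `|g| / (4 * B + `|g|).
have den0 : 0 < 4 * B + `|g| by rewrite ltr_wpDl // mulr_ge0.
have e0 : 0 < e by rewrite divr_gt0.
have e1 : e <= 1 by rewrite ler_pdivrMr // mul1r lerDr mulr_ge0.
have er : e \is Num.real by rewrite gtr0_real.
have Le : `|L.[e]| <= B by rewrite LB // gtr0_norm.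
have LNe : `|L.[- e]| <= B by rewrite LB // normrN gtr0_norm.
have Ht t : H.[t] = (L.[t] * t + g) * t by rewrite HE GE !hornerE.
have pos : 0 <= L.[e] * e + g by rewrite -(pmulr_lge0 _ e0) -Ht H_ge0.
have neg : 0 <= L.[- e] * e - g.
  rewrite -(pmulr_lge0 _ e0) (_ : _ * e = H.[- e]) ?H_ge0 ?rpredN // Ht; ring.
have sumE : L.[e] * e + L.[- e] * e = (L.[e] * e + g) + (L.[- e] * e - g) by ring.
have sum_le : L.[e] * e + g <= 2 * B * e.
  apply: (@le_trans _ _ (L.[e] * e + L.[- e] * e)).
    by rewrite sumE lerDl.
  rewrite -(ger0_norm (x := L.[e] * e + L.[- e] * e)); last first.
    by rewrite sumE addr_ge0.
  rewrite -mulrDl normrM (gtr0_norm e0) ler_pM2r // (le_trans (ler_normD _ _)) //.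
  by rewrite mulr_natl mulr2n lerD.
have : `|g| <= 3 * B * e.
  rewrite (_ : g = (L.[e] * e + g) - L.[e] * e); last by rewrite addrC addKr.
  rewrite (le_trans (ler_normB _ _)) // ger0_norm // normrM (gtr0_norm e0).
  apply: (le_trans (lerD sum_le (ler_wpM2r (ltW e0) Le))).
  by rewrite le_eqVlt; apply/orP; left; apply/eqP; ring.
rewrite /e mulrA ler_pdivlMr // mulrC ler_pM2r // => le.
have : 4 * B + `|g| <= 4 * B by rewrite (le_trans le) // ler_wpM2r // ler_nat.
by rewrite gerDl lt_geF.
Qed.

(** The number c + conj c is, up to a positive factor, the derivative at t = 0 of the
    nonnegative difference of the two sides of the hypothesis. *)
Lemma critical_direction (K : numClosedFieldType) (d : nat) (f p q : {poly K})
    (z w : K) :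
  (0 < d)%N -> f^`() = p *+ d -> f = q + 'X * p ->
  (forall t, t \is Num.real ->
     `|f.[z + t * w]| ^+ 2 * (1 + `|z| ^+ 2) ^+ d <=
     `|f.[z]| ^+ 2 * (1 + `|z + t * w| ^+ 2) ^+ d) ->
  let c := w * (f.[z])^* * (z^* * q.[z] - p.[z]) in c + c^* = 0.
Proof.
move=> d0 pE fE max c.
pose fc := map_poly (Num.conj : {rmorphism K -> K}) f.
pose l : {poly K} := z%:P + w *: 'X; pose lc : {poly K} := (z^*)%:P + w^* *: 'X.
have lt t : l.[t] = z + t * w by rewrite /l !hornerE mulrC.
have lct t : t \is Num.real -> lc.[t] = (z + t * w)^*.
  by move=> /CrealP tr; rewrite /lc !hornerE rmorphD rmorphM /= tr mulrC.
have fct x : fc.[x^*] = (f.[x])^* by rewrite /fc horner_map.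
have dl : l^`() = w%:P by rewrite /l derivD derivZ derivX derivC add0r alg_polyC.
have dlc : lc^`() = w^*%:P by rewrite /lc derivD derivZ derivX derivC add0r alg_polyC.
have dfc : fc^`() = map_poly (Num.conj : {rmorphism K -> K}) f^`().
  exact: deriv_map.
clearbody l lc fc.
(* The conjugates of f and of the line l are taken coefficientwise, which makes the
   difference a polynomial in t that agrees with it for real t. *)
pose H : {poly K} := ((f.[z] * (f.[z])^*)%:P * (1 + l * lc) ^+ d) -
  (f \Po l) * (fc \Po lc) * ((1 + z * z^*) ^+ d)%:P.
have HtE t : t \is Num.real -> H.[t] =
  `|f.[z]| ^+ 2 * (1 + `|z + t * w| ^+ 2) ^+ d -
  `|f.[z + t * w]| ^+ 2 * (1 + `|z| ^+ 2) ^+ d.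
  move=> tr; rewrite /H hornerD hornerN !hornerM !hornerC !horner_comp horner_exp.
  by rewrite !hornerD hornerM hornerC lt lct // fct !normCK.
have : H`_1 = 0.
  apply: poly_min_coef1 => [t tr|]; first by rewrite HtE // subr_ge0 max.
  by rewrite HtE ?rpred0 // !mul0r !addr0 subrr.
have -> : H`_1 = H^`().[0] by rewrite horner_coef0 coef_deriv mulr1n.
have l0 : l.[0] = z by rewrite lt mul0r addr0.
have lc0 : lc.[0] = z^* by rewrite lct ?rpred0 // mul0r addr0.
have f'z : f^`().[z] = p.[z] * d%:R by rewrite pE hornerMn mulr_natr.
have fz : f.[z] = q.[z] + z * p.[z] by rewrite {1}fE !hornerE.
rewrite /H derivB !derivM !derivC !mul0r add0r mulr0 addr0 deriv_exp.
rewrite !deriv_comp dl dlc derivD derivM dl dlc -polyC1 derivC add0r dfc.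
rewrite !(hornerM, hornerD, hornerN, hornerMn, horner_exp, horner_comp, hornerC).
rewrite l0 lc0 !fct horner_map /= f'z -mulr_natr.
rewrite -[in (1 + z * z^*) ^+ d](prednK d0) exprS.
set D := 1 + z * z^*; set E := D ^+ d.-1 => e.
have D0 : D != 0 by rewrite gt_eqF // ltr_wpDr ?mul_conjC_ge0.
have dK : d%:R * E != 0 by rewrite mulf_neq0 ?expf_neq0 // pnatr_eq0 -lt0n.
apply: (mulfI dK); rewrite mulr0 -[RHS]e /c !rmorphM rmorphD rmorphN !rmorphM /=.
rewrite !conjCK conjC_nat.
rewrite /D fz !rmorphD !rmorphM /=; ring.
Qed.

(** In the directions 1 and i the first-order condition annihilates the real and the
    imaginary part of conj (f z) (conj z q z - p z). *)
Lemma critical_point_complex (K : numClosedFieldType) (d : nat)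
    (f p q : {poly K}) (z : K) :
  (0 < d)%N -> f^`() = p *+ d -> f = q + 'X * p -> f.[z] != 0 ->
  (forall x, `|f.[x]| ^+ 2 * (1 + `|z| ^+ 2) ^+ d <=
             `|f.[z]| ^+ 2 * (1 + `|x| ^+ 2) ^+ d) ->
  p.[z] = z^* * q.[z].
Proof.
move=> d0 pE fE fz max.
have crit w := critical_direction d0 pE fE (fun t _ => max (z + t * w)).
set c := (f.[z])^* * (z^* * q.[z] - p.[z]).
have c1 : c + c^* = 0 by have := crit 1; rewrite /= mul1r.
have ci : c - c^* = 0.
  have := crit 'i; rewrite /= -mulrA -/c rmorphM /= conjCi mulNr -mulrBr => /eqP.
  by rewrite mulf_eq0 (negPf (neq0Ci K)) => /eqP.
have /eqP : c *+ 2 = 0 by rewrite mulr2n -{2}(subrK c^* c) ci add0r c1.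
rewrite mulrn_eq0 /= mulf_eq0 conjC_eq0 (negPf fz) subr_eq0 => /eqP -> //.
Qed.

Lemma critical_point_real (K : numClosedFieldType) (d : nat)
    (f p q : {poly K}) (z : K) :
  (0 < d)%N -> f^`() = p *+ d -> f = q + 'X * p -> f.[z] != 0 ->
  z \is Num.real -> p.[z] \is Num.real -> q.[z] \is Num.real ->
  (forall x, x \is Num.real -> `|f.[x]| ^+ 2 * (1 + `|z| ^+ 2) ^+ d <=
             `|f.[z]| ^+ 2 * (1 + `|x| ^+ 2) ^+ d) ->
  p.[z] = z * q.[z].
Proof.
move=> d0 pE fE fz zr pr qr max.
have max1 t : t \is Num.real -> `|f.[z + t * 1]| ^+ 2 * (1 + `|z| ^+ 2) ^+ d <=
    `|f.[z]| ^+ 2 * (1 + `|z + t * 1| ^+ 2) ^+ d.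
  by move=> tr; rewrite mulr1 max // rpredD.
have := critical_direction d0 pE fE max1; rewrite /=.
have fr : f.[z] \is Num.real by rewrite fE !hornerE rpredD ?rpredM.
move=> /eqP; rewrite mul1r (CrealP fr) (CrealP zr) conj_Creal; last first.
  by rewrite !(rpredM, rpredB).
by rewrite -mulr2n mulrn_eq0 /= mulf_eq0 (negPf fz) subr_eq0 => /eqP.
Qed.

(** The equation makes f divisible by X^2 + 1, and the quotient solves the same equation
    with d - 2 in place of d; an odd d would end with a linear polynomial divisible by
    X^2 + 1. *)
Lemma sphere_ode (K : numFieldType) (d : nat) (f : {poly K}) :
  (size f <= d.+1)%N -> ('X^2 + 1) * f^`() = ('X * f) *+ d -> f != 0 ->
  ~~ odd d /\ exists A, f = A *: ('X^2 + 1) ^+ d./2.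
Proof.
have X20 : 'X^2 + 1 != 0 :> {poly K}.
  by rewrite -size_poly_gt0 -polyC1 size_XnaddC.
(* X^2 g = (X^2 + 1) g - g is compared with X (X^2 + 1) g' = (n + 1) X^2 g. *)
have aux n (g : {poly K}) : ('X^2 + 1) * g^`() = ('X * g) *+ n.+1 ->
  exists h, g = ('X^2 + 1) * h.
  move=> ode; exists (g - n.+1%:R^-1 *: ('X * g^`())).
  have nK : n.+1%:R != 0 :> K by rewrite pnatr_eq0.
  apply: (scalerI nK); rewrite scalerAr scalerBr scalerA divff // scale1r mulrBr.
  by rewrite mulrCA ode -['X * g *+ _]mulr_natr -!mul_polyC polyC_natr; ring.
have [n le] := ubnP d; elim: n d f le => // n IH [|[|d]] f lt sf ode f0.
- move/eqP: ode; rewrite mulr0n mulf_eq0 (negPf X20) => /eqP /deriv0_size1 /size1_polyC ->.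
  by split=> //; exists f`_0; rewrite expr0 alg_polyC.
- have [h hE] := aux 0%N f ode; case/eqP: f0; rewrite hE in sf *.
  have [->|h0] := eqVneq h 0; first by rewrite mulr0.
  move: sf; rewrite size_mul // -polyC1 size_XnaddC //=.
  by rewrite -[(size h)]prednK ?size_poly_gt0.
have [h hE] := aux d.+1 f ode.
have h0 : h != 0 by apply: contraNneq f0 => h0; rewrite hE h0 mulr0.
have [|||//|od [A hA]] := IH d h.
- by rewrite -ltnS (leq_trans _ lt).
- move: sf; rewrite hE size_mul // -[1]polyC1 size_XnaddC //=.
- apply: (mulfI X20); move: ode; rewrite hE derivM derivD derivXn derivC addr0 => ode.
  have : ('X^2 + 1) * (('X^2 + 1) * h^`()) =
      ('X * (('X^2 + 1) * h)) *+ d.+2 - ('X^2 + 1) * ('X *+ 2 * h).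
    by rewrite -ode /=; ring.
  by move=> ->; rewrite !mulrS; ring.
- split; first by rewrite /= negbK.
  by exists A; rewrite hE hA -[d.+2./2]/(d./2.+1) (exprS _ d./2) scalerAr.
Qed.

(** * The polynomials attached to a symmetric tensor *)

Section Complex.
Variable R : realType.
Local Notation C := R[i].

Lemma norm_normc (z : C) : `|z| = (normc z)%:C.
Proof. by []. Qed.

Lemma conjE (a b : R) : (a +i* b)^* = (a -i* b) :> C.
Proof. by []. Qed.

Lemma expi_unit (t : R) : expi t * (expi t)^* = 1.
Proof.
rewrite /expi conjE; apply/eqP; rewrite eq_complex /=.
rewrite mulrN opprK -!expr2 cos2Dsin2 eqxx /= mulrN [X in - X + _]mulrC.
by rewrite addrC subrr.
Qed.

Lemma expi_surj (z : C) : z * z^* = 1 -> exists t, z = expi t.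
Proof.
case: z => x y; rewrite conjE => /eqP; rewrite eq_complex /= => /andP[/eqP xy _].
have {}xy : x ^+ 2 + y ^+ 2 = 1 by rewrite -xy mulrN opprK !expr2.
have x1 : -1 <= x <= 1.
  by apply/andP; split; nra.
have sin_ac : sin (acos x) = `|y|.
  by rewrite sin_acos // -xy addrAC subrr add0r sqrtr_sqr.
have [y0|y0] := leP 0 y.
  by exists (acos x); rewrite /expi acosK // sin_ac ger0_norm.
by exists (- acos x); rewrite /expi cosN sinN acosK // sin_ac ltr0_norm // opprK.
Qed.

Section Poly.
Variables (d : nat) (s : 'cV[C]_d.+1).
Hypothesis d0 : (0 < d)%N.
Local Notation phi := (phi_poly s).
Local Notation p := (p_poly s).
Local Notation q := (q_poly s).
Local Notation u := (u_poly s).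
Local Notation v := (v_poly s).

Lemma phi_polyE : phi = \poly_(j < d.+1) (entry s j *+ 'C(d, j)).
Proof. by rewrite poly_def. Qed.

Lemma p_polyE : p = \poly_(j < d) (entry s j.+1 *+ 'C(d.-1, j)).
Proof. by rewrite (poly_def d (fun j => entry s j.+1 *+ 'C(d.-1, j))). Qed.

Lemma q_polyE : q = \poly_(j < d) (entry s j *+ 'C(d.-1, j)).
Proof. by rewrite (poly_def d (fun j => entry s j *+ 'C(d.-1, j))). Qed.

Lemma coef_phi j : (j <= d)%N -> phi`_j = entry s j *+ 'C(d, j).
Proof. by move=> jd; rewrite phi_polyE coef_poly ltnS jd. Qed.

Lemma size_phi : (size phi <= d.+1)%N.
Proof. by rewrite phi_polyE size_poly. Qed.

Lemma phi_split : phi = q + 'X * p.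
Proof.
rewrite phi_polyE q_polyE p_polyE; case: d d0 s => // n _ r; apply/polyP => j.
rewrite coefD coefXM !coef_poly; case: j => [|j] /=; first by rewrite !bin0 addr0.
rewrite !ltnS; case: (ltngtP j n) => [jn|jn|->]; rewrite ?addr0 //.
  by rewrite binS mulrnDr.
by rewrite !binn add0r.
Qed.

Lemma deriv_phi : phi^`() = p *+ d.
Proof.
rewrite phi_polyE p_polyE; case: d d0 s => // n _ r; apply/polyP => j.
rewrite coef_deriv coefMn !coef_poly !ltnS; case: leqP => // _; last by rewrite !mul0rn.
by rewrite -!mulrnA mulnC -mul_bin_diag mulnC.
Qed.

(** The sum is the conjugate of the homogenised polynomial, evaluated at (b, a). *)
Lemma horner_homogeneous (e : nat -> C) (a b : C) : b != 0 ->
  \sum_(j < d) ((e j)^* *+ 'C(d.-1, j)) * (a ^+ j * b ^+ (d.-1 - j)) =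
  b ^+ d.-1 * ((\poly_(j < d) (e j *+ 'C(d.-1, j))).[(a / b)^*])^*.
Proof.
move=> b0; rewrite horner_poly rmorph_sum mulr_sumr; apply: eq_bigr => j _.
have jd : (j <= d.-1)%N by rewrite -ltnS prednK.
rewrite rmorphM rmorphXn rmorphMn /= conjCK expr_div_n.
have -> : b ^+ d.-1 = b ^+ (d.-1 - j) * b ^+ j by rewrite -exprD subnK.
by rewrite !mulrnAl !mulrnAr; congr (_ *+ _); field; rewrite expf_neq0.
Qed.

Lemma horner_u z : q.[z] != 0 ->
  u.[z] = q.[z] ^+ d.-1 * (p.[(p.[z] / q.[z])^*])^*.
Proof.
move=> qz; have := horner_homogeneous (fun j => entry s j.+1) p.[z] qz.
rewrite -p_polyE => <-; rewrite horner_sum.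
by apply: eq_bigr => j _; rewrite hornerZ hornerM !horner_exp.
Qed.

Lemma horner_v z : q.[z] != 0 ->
  v.[z] = q.[z] ^+ d.-1 * (q.[(p.[z] / q.[z])^*])^*.
Proof.
move=> qz; have := horner_homogeneous (fun j => entry s j) p.[z] qz.
rewrite -q_polyE => <-; rewrite horner_sum.
by apply: eq_bigr => j _; rewrite hornerZ hornerM !horner_exp.
Qed.

(** If q = 0, then only s_d survives, v = 0 and u is a nonzero multiple of a power of
    p. *)
Lemma q_neq0_of_fixed : phi != 0 -> 'X * v - u = 0 -> q != 0.
Proof.
move=> phi0 vu; apply/eqP => q0.
have e0 j : (j < d)%N -> entry s j = 0.
  move=> jd; have := congr1 (fun r : {poly C} => r`_j) q0.
  rewrite q_polyE coef_poly jd coef0 => /eqP.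
  by rewrite mulrn_eq0 -leqn0 leqNgt bin_gt0 -ltnS prednK // jd /= => /eqP.
have v0 : v = 0.
  by rewrite /v_poly big1 // => j _; rewrite e0 // rmorph0 mul0rn scale0r.
have := phi_split; rewrite q0 add0r => phiE.
have p0 : p != 0 by apply: contraNneq phi0 => p0; rewrite phiE p0 mulr0.
have ed : entry s d != 0.
  apply: contraNneq p0 => ed0; rewrite p_polyE; apply/eqP/polyP => j.
  rewrite coef_poly coef0; case: ltnP => // jd.
  have [->|jd'] := eqVneq j.+1 d; first by rewrite ed0 mul0rn.
  by rewrite e0 ?mul0rn // ltn_neqAle jd'.
move: vu; rewrite v0 mulr0 sub0r => /eqP; rewrite oppr_eq0.
have -> : u = (entry s d)^* *: p ^+ d.-1.
  have dl : (d.-1 < d)%N by rewrite prednK.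
  rewrite /u_poly (bigD1 (Ordinal dl)) //= big1 => [|j jd].
    by rewrite prednK // binn subnn expr0 mulr1 addr0.
  rewrite e0 ?rmorph0 ?mul0rn ?scale0r //.
  have := ltn_ord j; rewrite -{2}(prednK d0) ltnS leq_eqVlt => /orP[/eqP jE|].
    by case/eqP: jd; apply: val_inj.
  by rewrite -ltnS prednK.
by rewrite scaler_eq0 conjC_eq0 (negPf ed) expf_eq0 (negPf p0) andbF.
Qed.

(** At every z with q z <> 0, the value of z v - u is a power of q z times
    z conj (q (J z)) - conj (p (J z)). *)
Lemma fixed_polyP : phi != 0 ->
  'X * v - u = 0 <-> q != 0 /\ conj_involutive p q.
Proof.
move=> phi0; split=> [vu|[q0 pq]].
  split; first exact: q_neq0_of_fixed.
  move=> z qz w; have := congr1 (fun r : {poly C} => r.[z]) vu.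
  rewrite /= hornerD hornerN hornerM hornerX horner_u // horner_v // horner0 mulrCA.
  rewrite -mulrBr => /eqP; rewrite mulf_eq0 expf_eq0 (negPf qz) andbF /= subr_eq0.
  by move/eqP => e; rewrite -[RHS]conjCK -e [(z * _)^*]rmorphM /= conjCK.
apply: (poly_eq0_generic q0) => z qz; rewrite hornerD hornerN hornerM hornerX.
rewrite horner_u // horner_v // mulrCA -mulrBr -(pq z qz).
by rewrite [(z^* * _)^*]rmorphM /= conjCK subrr mulr0.
Qed.

Lemma monomial_formP :
  monomial_form s <-> exists A k, [/\ A != 0, (0 < k < d)%N & phi = A *: 'X^k].
Proof.
split=> [[k [A [kd A0 [ek ej]]]]|[A [k [A0 kd phiE]]]].
  have /andP[_ /ltnW kd'] := kd.
  exists (A *+ 'C(d, k)), k; split=> //.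
    by rewrite mulrn_eq0 -leqn0 leqNgt bin_gt0 kd'.
  apply/polyP => j; rewrite coefZ coefXn phi_polyE coef_poly ltnS.
  have [jk|jk] := eqVneq j k; first by rewrite jk kd' ek mulr1.
  by rewrite mulr0; case: leqP => // jd; rewrite ej // mul0rn.
have /andP[_ /ltnW kd'] := kd.
have Ck : 'C(d, k)%:R != 0 :> C by rewrite pnatr_eq0 -lt0n bin_gt0.
exists k, (A / 'C(d, k)%:R); split=> //; first by rewrite mulf_neq0 // invr_eq0.
have eE j : (j <= d)%N -> entry s j = A * (j == k)%:R / 'C(d, j)%:R.
  move=> jd; have Cj : 'C(d, j)%:R != 0 :> C by rewrite pnatr_eq0 -lt0n bin_gt0.
  apply: (mulIf Cj); rewrite mulfVK // [LHS]mulr_natr -coef_phi // phiE.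
  by rewrite coefZ coefXn.
split=> [|j jd jk]; first by rewrite eE // eqxx mulr1.
by rewrite eE // (negPf jk) mulr0 mul0r.
Qed.

Lemma two_root_formP :
  two_root_form s <-> exists A a b m, [/\ A != 0, (0 < m < d)%N, a * b^* = -1 &
      phi = A *: (('X + a%:P) ^+ m * ('X + b%:P) ^+ (d - m))].
Proof.
split=> [[A [c [t [m [A0 c0 md phiE]]]]]|[A [a [b [m [A0 md ab phiE]]]]]].
  exists A, (expi (- t) * c%:C), (- expi (- t) * (c^-1)%:C), m; split=> //.
  rewrite rmorphM rmorphN /= mulrACA mulrN expi_unit mulN1r.
  have -> : (c^-1)%:C^* = (c^-1)%:C :> C by rewrite conjE oppr0.
  by rewrite -[c%:C * _](rmorphM (real_complex R)) /= divff.
have a0 : a != 0 by apply: contra_eq_neq ab => ->; rewrite mul0r eq_sym oppr_eq0 oner_neq0.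
pose c := normc a.
have cE : c%:C = `|a| by [].
have c0 : c != 0 by rewrite -(inj_eq (@complexI R)) cE normr_eq0.
have [t tE] : exists t, a / c%:C = expi t.
  apply: expi_surj; rewrite cE rmorphM /= fmorphV /= conj_normC mulrACA -normCK.
  by rewrite expr2 -invfM divff // mulf_neq0 // normr_eq0.
have aE : a = expi t * c%:C by rewrite -tE divfK // cE normr_eq0.
exists A, c, (- t), m; split=> //=; rewrite opprK -aE.
suff -> : - expi t * (c^-1)%:C = b by [].
have bE : b = - (a^*)^-1.
  by apply: (mulfI (_ : a^* != 0)); rewrite ?conjC_eq0 // mulrN divff ?conjC_eq0 //
    -[b]conjCK -rmorphM ab rmorphN /= conjC1.
rewrite bE mulNr; congr (- _).
apply: (mulfI (_ : a^* != 0)); rewrite ?conjC_eq0 // divff ?conjC_eq0 //.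
rewrite {1}aE rmorphM /= mulrACA [_^* * _]mulrC expi_unit mul1r.
have -> : c%:C^* = c%:C :> C by rewrite conjE oppr0.
by rewrite -[c%:C * _](rmorphM (real_complex R)) /= divff.
Qed.

Lemma fixed_poly_eq0 : phi != 0 ->
  'X * v - u = 0 <-> monomial_form s \/ two_root_form s.
Proof.
move=> phi0; split=> [/(fixed_polyP phi0)[q0 pq]|forms].
  have [/monomial_formP|/two_root_formP] :=
    conj_involutive_forms d0 deriv_phi phi_split phi0 size_phi q0 pq; by [left|right].
apply/(fixed_polyP phi0); case: forms.
  move=> /monomial_formP[A [k [A0 kd E]]].
  exact: (monomial_conj_involutive d0 deriv_phi phi_split A0 kd E).
move=> /two_root_formP[A [a [b [m [A0 md ab E]]]]].
exact: (antipodal_conj_involutive d0 deriv_phi phi_split A0 md ab E).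
Qed.

End Poly.
End Complex.

(** * Values of a binary form on the unit sphere *)

Section Values.
Variable R : realType.
Local Notation C := R[i].

Lemma normcX (z : C) n : normc (z ^+ n) = normc z ^+ n.
Proof.
elim: n => [|n IH]; first by rewrite !expr0 normc1.
by rewrite !exprS normcM IH.
Qed.

Lemma normc_ge0 (z : C) : 0 <= normc z.
Proof. by rewrite -lecR -norm_normc normr_ge0. Qed.

Lemma normc_real (a : R) : normc a%:C = `|a|.
Proof. by rewrite /= expr0n /= addr0 sqrtr_sqr. Qed.

Lemma powR_half (a : R) n : 0 <= a -> a `^ (n%:R / 2) = Num.sqrt a ^+ n.
Proof.
by move=> a0; rewrite mulrC powRrM powR12_sqrt // powR_mulrn // sqrtr_ge0.
Qed.

Definition vec2 (a b : C) : 'cV[C]_2 := \col_k (if k == 0 then a else b).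

Lemma vec2_0 a b : vec2 a b 0 0 = a. Proof. by rewrite mxE. Qed.

Lemma vec2_1 a b : vec2 a b 1 0 = b. Proof. by rewrite mxE. Qed.

Lemma l2norm_unit (x : 'cV[C]_2) :
  l2norm x = 1 <-> normc (x 0 0) ^+ 2 + normc (x 1 0) ^+ 2 = 1.
Proof.
rewrite l2norm1 big_ord_recl big_ord1 (_ : lift ord0 ord0 = 1) //.
exact: val_inj.
Qed.

Lemma in_base_vec2 F a b : in_base F a -> in_base F b ->
  forall k, in_base F (vec2 a b k 0).
Proof. by move=> aF bF k; rewrite mxE; case: ifP. Qed.

Section Tensor.
Variables (d : nat) (S : tensor R d) (s : 'cV[C]_d.+1).
Hypotheses (d0 : (0 < d)%N) (Ss : associated S s).
Local Notation phi := (phi_poly s).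
Local Notation p := (p_poly s).
Local Notation q := (q_poly s).

Lemma twos_le (i : mode_index d) : (twos i <= d)%N.
Proof. by rewrite /twos -[X in (_ <= X)%N]card_ord max_card. Qed.

Lemma twosE (i : mode_index d) : twos i = (\sum_(k < d) i k)%N.
Proof.
rewrite /twos -sum1_card big_mkcond; apply: eq_bigr => k _; rewrite inE.
by case: (i k) => [[|[|]]].
Qed.

Lemma exists_twos j : (j <= d)%N -> exists i : mode_index d, twos i = j.
Proof.
move=> jd; exists [ffun k : 'I_d => if (k < j)%N then 1 else 0]; rewrite twosE.
rewrite (eq_bigr (fun k : 'I_d => if (k < j)%N then 1%N else 0%N)); last first.
  by move=> k _; rewrite ffunE; case: ifP.
by rewrite -big_mkcond /= -(big_ord_widen _ (fun=> 1%N)) // sum1_card card_ord.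
Qed.

Definition binary_form (a b : C) : C :=
  \sum_(j < d.+1) (entry s j *+ 'C(d, j)) * (a ^+ (d - j) * b ^+ j).

(** Both sides are the coefficient of X^j in (x_1 + x_2 X)^d. *)
Lemma sum_twos (x : 'cV[C]_2) (j : nat) : (j <= d)%N ->
  \sum_(i : mode_index d | twos i == j) \prod_(k < d) x (i k) 0 =
  (x 0 0 ^+ (d - j) * x 1 0 ^+ j) *+ 'C(d, j).
Proof.
move=> jd.
have E : ((x 0 0)%:P + x 1 0 *: 'X) ^+ d =
    \sum_(i : mode_index d) (\prod_(k < d) x (i k) 0) *: 'X^(twos i).
  transitivity (\prod_(k < d) \sum_(b < 2) x b 0 *: 'X^b).
    rewrite prodr_const card_ord big_ord_recl big_ord1 expr0 alg_polyC.
    by congr ((_ + x _ 0 *: _) ^+ _); apply: val_inj.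
  rewrite bigA_distr_bigA; apply: eq_bigr => i _.
  by rewrite scaler_prod -expr_sum -twosE.
have Er : (\sum_(i : mode_index d) (\prod_(k < d) x (i k) 0) *: 'X^(twos i))`_j =
    \sum_(i : mode_index d | twos i == j) \prod_(k < d) x (i k) 0.
  rewrite coef_sum [RHS]big_mkcond; apply: eq_bigr => i _.
  by rewrite coefZ coefXn eq_sym; case: eqP => _; rewrite ?mulr1 ?mulr0.
rewrite -Er -E exprDn coef_sum (bigD1 (Ordinal (jd : (j < d.+1)%N))) //=.
rewrite big1 ?addr0 => [|i ij].
  by rewrite coefMn exprZn -polyC_exp mul_polyC !coefZ coefXn eqxx mulr1.
rewrite coefMn exprZn -polyC_exp mul_polyC !coefZ coefXn.
have /negPf -> : (j != i :> nat) by rewrite eq_sym.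
by rewrite !mulr0 mul0rn.
Qed.

Lemma tensor_eval_form (x : 'cV[C]_2) :
  tensor_eval S x = binary_form (x 0 0) (x 1 0).
Proof.
rewrite /tensor_eval (partition_big (fun i => inord (twos i) : 'I_d.+1) xpredT) //=.
apply: eq_bigr => j _; have jd : (j <= d)%N by rewrite -ltnS.
rewrite mulrnAl -mulrnAr -sum_twos // mulr_sumr; apply: eq_big => i.
  by rewrite -val_eqE /= inordK // ltnS twos_le.
by move=> /eqP ij; rewrite Ss ij /entry inord_val.
Qed.

Lemma binary_form_affine a b : a != 0 -> binary_form a b = a ^+ d * phi.[b / a].
Proof.
move=> a0; rewrite phi_polyE horner_poly mulr_sumr; apply: eq_bigr => j _.
have jd : (j <= d)%N by rewrite -ltnS.
rewrite expr_div_n -[in a ^+ d](subnK jd) exprD; field; exact: expf_neq0.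
Qed.

Lemma binary_form_infty b : binary_form 0 b = entry s d * b ^+ d.
Proof.
rewrite /binary_form big_ord_recr /= big1 ?add0r => [|j _].
  by rewrite binn subnn expr0 mul1r.
by rewrite expr0n subn_eq0 leqNgt ltn_ord /= mul0r mulr0.
Qed.

Lemma phi_ratioE z : phi_ratio s z =
  normc phi.[z] / Num.sqrt (1 + normc z ^+ 2) ^+ d.
Proof. by rewrite /phi_ratio powR_half // addr_ge0 ?sqr_ge0. Qed.

(** The point (x_1, x_2) with x_1 <> 0 is sent to z = x_2 / x_1, which lies in F, and
    |x_1|^2 (1 + |z|^2) = 1 on the unit sphere. *)
Lemma spectral_valuesE F : spectral_values F S =
  [set normc (entry s d)] `|` [set phi_ratio s z | z in [set z | in_base F z]].
Proof.
apply/seteqP; split=> r /=.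
  move=> [x [xF /l2norm_unit x1] <-].
  rewrite tensor_eval_form; set a := x 0 0 in x1 *; set b := x 1 0 in x1 *.
  have [a0|a0] := eqVneq a 0.
    left; move: x1; rewrite a0 normc0 expr0n add0r => /eqP.
    rewrite sqrp_eq1 ?normc_ge0 // => /eqP b1.
    by rewrite binary_form_infty normcM normcX b1 expr1n mulr1.
  right; exists (b / a).
    by move: (xF 0) (xF 1); case: (F) => //=; rewrite -/a -/b => ar br; rewrite rpred_div.
  have na0 : normc a != 0 by rewrite -(inj_eq (@complexI R)) -norm_normc normr_eq0.
  have na : 0 < normc a by rewrite lt0r na0 normc_ge0.
  rewrite phi_ratioE binary_form_affine // !normcM normcX.
  rewrite normcV.
  rewrite (_ : 1 + _ = (normc a)^-1 ^+ 2); last first.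
    transitivity ((normc a ^+ 2 + normc b ^+ 2) * (normc a)^-1 ^+ 2); first by field.
    by rewrite x1 mul1r.
  by rewrite sqrtr_sqr gtr0_norm ?invr_gt0 // exprVn invrK mulrC.
move=> [->|[z zF <-]].
  exists (vec2 0 1).
    split; first by apply: in_base_vec2; case: (F); rewrite //= ?rpred0 ?rpred1.
    apply/l2norm_unit; rewrite vec2_0 vec2_1 normc0.
    by rewrite normc1 expr0n expr1n add0r.
  by rewrite tensor_eval_form vec2_0 vec2_1 binary_form_infty expr1n mulr1.
pose c : R := (Num.sqrt (1 + normc z ^+ 2))^-1.
have n0 : 0 < 1 + normc z ^+ 2 by rewrite ltr_pwDl // sqr_ge0.
have c0 : 0 < c by rewrite invr_gt0 sqrtr_gt0.
have cC : c%:C != 0 by apply: contraTneq c0 => /(@complexI _ c 0) ->; rewrite ltxx.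
have cr : c%:C \is Num.real by apply/complex_realP; exists c.
exists (vec2 c%:C (c%:C * z)).
  split; first by apply: in_base_vec2; move: zF; case: (F) => //= zr; rewrite rpredM.
  apply/l2norm_unit; rewrite vec2_0 vec2_1 normcM normc_real.
  rewrite gtr0_norm // exprMn -[X in X + _]mulr1 -mulrDr /c exprVn.
  by rewrite sqr_sqrtr ?ltW // mulVf // gt_eqF.
rewrite tensor_eval_form vec2_0 vec2_1 binary_form_affine //.
rewrite [c%:C * z]mulrC mulfK // normcM normcX normc_real.
by rewrite gtr0_norm // phi_ratioE /c exprVn mulrC.
Qed.

End Tensor.
End Values.

(** * Spectral norms as maxima *)

Section Maxima.
Variables (R : realType) (d : nat) (S : tensor R d) (s : 'cV[R[i]]_d.+1).
Local Notation C := R[i].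
Hypotheses (d0 : (0 < d)%N) (Ss : associated S s).
Local Notation phi := (phi_poly s).
Local Notation p := (p_poly s).
Local Notation q := (q_poly s).
Local Notation u := (u_poly s).
Local Notation v := (v_poly s).

Lemma phi_neq0 : S != 0 -> phi != 0.
Proof.
apply: contraNneq => phi0; apply/eqP/ffunP => i; rewrite ffunE Ss.
have := congr1 (fun r : {poly C} => r`_(twos i)) phi0.
rewrite coef_phi ?twos_le // coef0 => /eqP.
by rewrite mulrn_eq0 -leqn0 leqNgt bin_gt0 twos_le /= => /eqP.
Qed.

Lemma spectral_norm_values F r : spectral_values F S r -> r <= spectral_norm F S.
Proof. by case: (spectral_norm_max F S) => _; apply. Qed.

Lemma entry_le_spectral_norm F : normc (entry s d) <= spectral_norm F S.
Proof. by apply: spectral_norm_values; rewrite (spectral_valuesE Ss); left. Qed.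

Lemma phi_ratio_le_spectral_norm F z :
  in_base F z -> phi_ratio s z <= spectral_norm F S.
Proof.
by move=> zF; apply: spectral_norm_values; rewrite (spectral_valuesE Ss); right; exists z.
Qed.

(** Squaring and clearing denominators removes the real power, which prepares for the
    polynomial first-order conditions. *)
Lemma phi_ratio_sqr_le (x z : C) : phi_ratio s x <= phi_ratio s z ->
  `|phi.[x]| ^+ 2 * (1 + `|z| ^+ 2) ^+ d <= `|phi.[z]| ^+ 2 * (1 + `|x| ^+ 2) ^+ d.
Proof.
pose D (y : C) : R := 1 + normc y ^+ 2.
have D0 y : 0 < D y by rewrite ltr_pwDl // sqr_ge0.
have sq y : phi_ratio s y ^+ 2 = normc phi.[y] ^+ 2 / D y ^+ d.
  rewrite phi_ratioE expr_div_n -exprM mulnC exprM sqr_sqrtr //.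
  exact: (ltW (D0 y)).
have ge0 y : 0 <= phi_ratio s y.
  by rewrite phi_ratioE divr_ge0 ?normc_ge0 // exprn_ge0 ?sqrtr_ge0.
rewrite -(@ler_pXn2r _ 2) ?nnegrE // !sq.
rewrite ler_pdivrMr ?exprn_gt0 // mulrAC ler_pdivlMr ?exprn_gt0 // => le.
rewrite !norm_normc -(rmorph1 (real_complex R)) -!rmorphXn -!rmorphD -!rmorphXn.
by rewrite -!rmorphM lecR.
Qed.

Lemma maximizer_nonroot F (z : C) : phi != 0 ->
  (forall x, in_base F x -> phi_ratio s x <= phi_ratio s z) -> phi.[z] != 0.
Proof.
move=> phi0 max; have [n] := exists_nat_nonroot phi0; apply: contraNneq => z0.
have /max/phi_ratio_sqr_le : in_base F (n%:R : C) by case: (F); rewrite //= realn.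
rewrite z0 normr0 expr0n mul0r pmulr_lle0 ?exprn_gt0 ?ltr_pwDl ?exprn_ge0 //.
by rewrite real_exprn_even_le0 //= normr_eq0.
Qed.

(** The values at the points of P are values of |f| on the sphere, so they cannot exceed
    the norm; the norm itself is |s_d| or is reached at a finite z, which is then a
    maximiser. *)
Lemma max_spectral_values F (P : set C) :
  P `<=` in_base F ->
  (forall z, in_base F z ->
    (forall x, in_base F x -> phi_ratio s x <= phi_ratio s z) -> P z) ->
  is_maximum ([set normc (entry s d)] `|` [set phi_ratio s z | z in P])
    (spectral_norm F S).
Proof.
move=> PF Pmax; split; last first.
  move=> _ [->|[z Pz <-]]; first exact: entry_le_spectral_norm.
  exact/phi_ratio_le_spectral_norm/PF.
have [] := spectral_norm_max F S; rewrite (spectral_valuesE Ss) => -[->|[z zF zE]] _.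
  by left.
right; exists z => //; apply: Pmax => // x xF.
by rewrite zE; apply: phi_ratio_le_spectral_norm.
Qed.

Lemma spectral_norm_complex : phi != 0 ->
  is_maximum ([set normc (entry s d)] `|`
      [set phi_ratio s z | z in [set z | root ('X * v - u) z]])
    (spectral_norm BaseC S).
Proof.
move=> phi0; apply: max_spectral_values => // z _ max /=.
have fz := maximizer_nonroot phi0 max.
have pz := critical_point_complex d0 (deriv_phi s d0) (phi_split s d0) fz
  (fun x => phi_ratio_sqr_le (max x isT)).
have qz : q.[z] != 0.
  by apply: contraNneq fz => q0; rewrite (phi_split s d0) !hornerE pz q0 !mulr0 addr0.
rewrite /root hornerD hornerN hornerM hornerX horner_u // horner_v //.
by rewrite pz mulfK // conjCK pz rmorphM /= conjCK mulrCA subrr.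
Qed.

Lemma finite_roots (f : {poly C}) : f != 0 -> finite_set [set z | root f z].
Proof.
move=> f0; have [rs rsE] := closed_field_poly_normal f.
apply: sub_finite_set (finite_seq rs) => z /=.
by rewrite rsE rootZ ?lead_coef_eq0 // root_prod_XsubC.
Qed.

Lemma entry_real j : tensor_over BaseR S -> (j <= d)%N -> entry s j \is Num.real.
Proof.
by move=> SR /exists_twos[i <-]; rewrite /entry -Ss; apply: SR.
Qed.

Lemma p_real z : tensor_over BaseR S -> z \is Num.real -> p.[z] \is Num.real.
Proof.
move=> SR zr; rewrite p_polyE horner_poly rpred_sum // => j _.
by rewrite rpredM ?rpredX // rpredMn // entry_real.
Qed.

Lemma q_real z : tensor_over BaseR S -> z \is Num.real -> q.[z] \is Num.real.
Proof.
move=> SR zr; rewrite q_polyE horner_poly rpred_sum // => j _.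
by rewrite rpredM ?rpredX // rpredMn // entry_real // ltnW.
Qed.

Lemma spectral_norm_real : phi != 0 -> tensor_over BaseR S ->
  is_maximum ([set normc (entry s d)] `|` [set phi_ratio s z | z in
      [set z | root ('X * q - p) z] `&` [set z | z \is Num.real]])
    (spectral_norm BaseR S).
Proof.
move=> phi0 SR; apply: max_spectral_values => [z []//|z zr max]; split=> //=.
have fz := maximizer_nonroot phi0 max.
have pz := critical_point_real d0 (deriv_phi s d0) (phi_split s d0) fz zr
  (p_real SR zr) (q_real SR zr) (fun x xr => phi_ratio_sqr_le (max x xr)).
by rewrite /root hornerD hornerN hornerM hornerX pz subrr.
Qed.

(** For z q = p the identities phi = q + z p and phi' = d p become
    phi = (1 + z^2) q and phi' = d z q. *)
Lemma sphere_formP : phi != 0 -> 'X * q - p = 0 <-> exists A, sphere_form s A.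
Proof.
move=> phi0; split=> [/eqP|[A [od phiE]]].
  rewrite subr_eq0 => /eqP qp; have phiq : phi = ('X^2 + 1) * q.
    by rewrite (phi_split s d0) -qp; ring.
  have ode : ('X^2 + 1) * phi^`() = ('X * phi) *+ d.
    by rewrite (deriv_phi s d0) -qp phiq mulrnAr; congr (_ *+ _); ring.
  have [od [A phiE]] := sphere_ode (size_phi s) ode phi0.
  by exists A; split.
have dK : d%:R != 0 :> C by rewrite pnatr_eq0 -lt0n.
have [m mE] : exists m, d./2 = m.+1.
  case: (d./2) (odd_double_half d) => [|m _]; last by exists m.
  by rewrite (negPf od) => dE; move: d0; rewrite -dE.
have dE : d = (m.+1 * 2)%N.
  by rewrite -[LHS]odd_double_half (negPf od) mE add0n muln2.
apply: (scalerI dK); rewrite scaler0 scaler_nat.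
have -> : 'X * q - p = 'X * phi - ('X^2 + 1) * p by rewrite (phi_split s d0); ring.
rewrite mulrnBl -[_ * p *+ d]mulrnAr -(deriv_phi s d0) phiE mE derivZ deriv_exp.
rewrite derivD derivXn -polyC1 derivC addr0 /= expr1 -!mul_polyC dE.
by rewrite exprS mulrnA !mulrnAl !mulrnAr; ring.
Qed.

Lemma spectral_norm_sphere A : sphere_form s A ->
  spectral_norm BaseR S = normc A.
Proof.
move=> [od phiE].
have dE : d = (d./2 * 2)%N by rewrite -[LHS]odd_double_half (negPf od) add0n muln2.
have X2m : ('X^2 + 1 : {poly C}) \is monic by rewrite -polyC1 monicXnaddC.
have ed : normc (entry s d) = normc A.
  congr normc; rewrite -[LHS]mulr1n -(binn d) -coef_phi // phiE coefZ.
  have -> : (('X^2 + 1 : {poly C}) ^+ d./2)`_d = lead_coef (('X^2 + 1) ^+ d./2).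
    by rewrite lead_coefE; congr (_`_ _); rewrite size_exp -polyC1 size_XnaddC //= {1}dE mulnC.
  by rewrite (monicP _) ?mulr1 ?monic_exp.
have rz z : z \is Num.real -> phi_ratio s z = normc A.
  case/complex_realP => a ->; rewrite phi_ratioE phiE hornerZ horner_exp.
  rewrite hornerD hornerXn hornerC normcM normcX normc_real.
  have -> : a%:C ^+ 2 + 1 = (1 + `|a| ^+ 2)%:C :> C.
    by rewrite real_normK ?num_real // rmorphD rmorphXn rmorph1 addrC.
  have n0 : 0 < 1 + `|a| ^+ 2 by rewrite ltr_pwDl // sqr_ge0.
  rewrite normc_real gtr0_norm // [in X in _ / X]dE mulnC exprM sqr_sqrtr ?ltW //.
  by rewrite mulfK // expf_neq0 // gt_eqF.
have [+ _] := spectral_norm_max BaseR S; rewrite (spectral_valuesE Ss).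
by case=> [->|[z zF <-]] //; apply: rz.
Qed.

(** From a n / m <= exp (a n / m - 1) with n = m + k one gets
    a^m <= (m / n)^m exp (a n - m); in the product of this bound and the one for b the
    exponentials cancel. *)
Lemma weighted_AMGM (m k : nat) (a b : R) : (0 < m)%N -> (0 < k)%N ->
  0 <= a -> 0 <= b -> a + b = 1 ->
  a ^+ m * b ^+ k <= (m%:R / (m + k)%:R) ^+ m * (k%:R / (m + k)%:R) ^+ k.
Proof.
move=> m0 k0 a0 b0 ab; set n : R := (m + k)%:R.
have nE : n = m%:R + k%:R by rewrite /n natrD.
have n0 : 0 < n by rewrite ltr0n addn_gt0 m0.
clearbody n.
have bound j x : (0 < j)%N -> 0 <= x ->
    x ^+ j <= (j%:R / n) ^+ j * expR (x * n - j%:R).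
  move=> j0 x0; have jR : 0 < j%:R :> R by rewrite ltr0n.
  have -> : expR (x * n - j%:R) = expR (x * n / j%:R - 1) ^+ j.
    by rewrite -expRM_natl; congr expR; field; rewrite gt_eqF.
  have xE : x = j%:R / n * (x * n / j%:R) by field; rewrite (gt_eqF jR) (gt_eqF n0).
  rewrite -exprMn; apply: lerXn2r; rewrite ?nnegrE //.
    by rewrite mulr_ge0 ?expR_ge0 ?divr_ge0 ?(ltW n0) ?(ltW jR).
  rewrite {1}xE ler_wpM2l ?divr_ge0 ?(ltW n0) ?(ltW jR) //.
  by have := expR_ge1Dx (x * n / j%:R - 1); rewrite addrC subrK.
apply: le_trans (ler_pM _ _ (bound m a m0 a0) (bound k b k0 b0)) _; rewrite ?exprn_ge0 //.
rewrite mulrACA -expRD (_ : _ + _ = 0) ?expR0 ?mulr1 //.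
transitivity ((a + b) * n - (m%:R + k%:R)); first by ring.
by rewrite ab mul1r nE subrr.
Qed.

Lemma single_entryP (k : nat) (A : C) : (0 < k < d)%N ->
  single_entry s k A <->
  forall x : 'cV[C]_2,
    tensor_eval S x = A * 'C(d, k)%:R * x 0 0 ^+ (d - k) * x 1 0 ^+ k.
Proof.
move=> /andP[k0 /ltnW kd]; split=> [[ek ej] x|Sx].
  rewrite (tensor_eval_form Ss) /binary_form (bigD1 (Ordinal (kd : (k < d.+1)%N))) //=.
  rewrite big1 ?addr0 => [|j jk]; last by rewrite ej ?mul0rn ?mul0r // -ltnS.
  by rewrite ek mulr_natr mulrA.
have phiE : phi = (A *+ 'C(d, k)) *: 'X^k.
  apply/eqP; rewrite -subr_eq0; apply/eqP/(poly_eq0_generic (oner_neq0 _)) => z _.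
  have := Sx (vec2 1 z); rewrite (tensor_eval_form Ss) vec2_0 vec2_1.
  rewrite binary_form_affine ?oner_neq0 // !expr1n mul1r divr1 mulr1 => fz.
  by rewrite hornerD hornerN hornerZ hornerXn fz mulr_natr subrr.
have eE j : (j <= d)%N -> entry s j = if j == k then A else 0.
  move=> jd; have Cj : 'C(d, j)%:R != 0 :> C by rewrite pnatr_eq0 -lt0n bin_gt0.
  apply: (mulIf Cj); rewrite [LHS]mulr_natr -coef_phi // phiE coefZ coefXn.
  by case: eqP => [->|_]; rewrite ?mulr0 ?mul0r // mulr1 mulr_natr.
by split=> [|j jd jk]; rewrite eE ?eqxx ?(negPf jk).
Qed.

(** With a = 1 / (1 + |z|^2) and b = |z|^2 / (1 + |z|^2), which add up to one, the ratio
    at z is a constant times sqrt a ^ (d - k) * sqrt b ^ k; the maximum is reached at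
    |z|^2 = k / (d - k), hence at a real z. *)
Lemma spectral_norm_monomial F (k : nat) (A : C) : (0 < k < d)%N ->
  single_entry s k A ->
  spectral_norm F S = normc A * 'C(d, k)%:R
                * (1 - k%:R / d%:R) `^ ((d - k)%:R / 2)
                * (k%:R / d%:R) `^ (k%:R / 2).
Proof.
move=> kd [ek ej]; have /andP[k0 kd'] := kd.
have dR : d%:R = (d - k)%:R + k%:R :> R by rewrite -natrD subnK // ltnW.
have dR0 : 0 < d%:R :> R by rewrite ltr0n.
have dk0 : 0 < (d - k)%:R :> R by rewrite ltr0n subn_gt0.
have kR0 : 0 < k%:R :> R by rewrite ltr0n.
have kaE : 1 - k%:R / d%:R = (d - k)%:R / d%:R :> R.
  by rewrite dR; field; rewrite -dR gt_eqF.
rewrite kaE !powR_half ?divr_ge0 ?ler0n //.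
set al : R := (d - k)%:R / d%:R; set be : R := k%:R / d%:R.
have al0 : 0 < al by rewrite divr_gt0.
have be0 : 0 < be by rewrite divr_gt0.
pose c := normc A * 'C(d, k)%:R.
have c0 : 0 <= c by rewrite mulr_ge0 ?normc_ge0.
have phiz z : normc phi.[z] = c * normc z ^+ k.
  rewrite phi_polyE horner_poly (bigD1 (Ordinal (ltnW kd' : (k < d.+1)%N))) //=.
  rewrite big1 ?addr0 => [|j jk]; last by rewrite ej ?mul0rn ?mul0r // -ltnS.
  rewrite ek normcM normcX -mulr_natr normcM.
  by rewrite -(rmorph_nat (real_complex R)) normc_real normr_nat.
have ed : entry s d = 0 by rewrite ej // gtn_eqF.
have ratioE z : phi_ratio s z =
    c * (Num.sqrt (1 / (1 + normc z ^+ 2)) ^+ (d - k) *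
         Num.sqrt (normc z ^+ 2 / (1 + normc z ^+ 2)) ^+ k).
  have D0 : 0 < 1 + normc z ^+ 2 by rewrite ltr_pwDl // sqr_ge0.
  have sD0 : Num.sqrt (1 + normc z ^+ 2) != 0 by rewrite gt_eqF // sqrtr_gt0.
  rewrite phi_ratioE phiz div1r sqrtrV ?ltW // sqrtrM ?sqr_ge0 // sqrtrV ?ltW //.
  rewrite sqrtr_sqr ger0_norm ?normc_ge0 // exprMn !exprVn.
  set D := Num.sqrt (1 + normc z ^+ 2) in sD0 *.
  have -> : D ^+ d = D ^+ (d - k) * D ^+ k by rewrite -exprD subnK // ltnW.
  by field; rewrite !expf_neq0.
apply/eqP; rewrite eq_le; apply/andP; split.
  have [+ _] := spectral_norm_max F S; rewrite (spectral_valuesE Ss).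
  case=> [->|[z zF <-]].
    by rewrite ed normc0 !mulr_ge0 ?normc_ge0 ?exprn_ge0 ?sqrtr_ge0.
  rewrite ratioE -/c -(mulrA c) ler_wpM2l //.
  have D0 : 0 < 1 + normc z ^+ 2 by rewrite ltr_pwDl // sqr_ge0.
  have a0 : 0 <= 1 / (1 + normc z ^+ 2) by rewrite divr_ge0 // ltW.
  have b0 : 0 <= normc z ^+ 2 / (1 + normc z ^+ 2) by rewrite divr_ge0 ?sqr_ge0 // ltW.
  have ab : 1 / (1 + normc z ^+ 2) + normc z ^+ 2 / (1 + normc z ^+ 2) = 1.
    by rewrite -mulrDl divff // gt_eqF.
  have dk : (0 < d - k)%N by rewrite subn_gt0.
  have := weighted_AMGM dk k0 a0 b0 ab; rewrite subnK 1?ltnW // -/al -/be => AG.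
  rewrite -(@ler_pXn2r _ 2) ?nnegrE ?mulr_ge0 ?exprn_ge0 ?sqrtr_ge0 //.
  have sq x y : 0 <= x -> 0 <= y ->
      (Num.sqrt x ^+ (d - k) * Num.sqrt y ^+ k) ^+ 2 = x ^+ (d - k) * y ^+ k :> R.
    by move=> x0 y0; rewrite exprMn -!exprM ![(_ * 2)%N]mulnC !exprM !sqr_sqrtr.
  by rewrite !sq ?(ltW al0) ?(ltW be0).
pose r := Num.sqrt (k%:R / (d - k)%:R) : R.
have r2 : normc (r%:C) ^+ 2 = k%:R / (d - k)%:R.
  by rewrite normc_real real_normK ?num_real // sqr_sqrtr // divr_ge0 ?ltW.
have rF : in_base F r%:C by case: (F) => //=; apply/complex_realP; exists r.
have := phi_ratio_le_spectral_norm rF; rewrite ratioE r2.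
have -> : 1 / (1 + k%:R / (d - k)%:R) = al.
  by rewrite /al dR; field; rewrite !gt_eqF // -?dR // addr_gt0.
have -> : k%:R / (d - k)%:R / (1 + k%:R / (d - k)%:R) = be.
  by rewrite /be dR; field; rewrite !gt_eqF // -?dR // addr_gt0.
by rewrite !mulrA.
Qed.

End Maxima.

(** * A program for the spectral norm *)

(** Total correctness: c started in st halts, in a store that satisfies Q.  The lemmas
    below compute with Q as with a weakest precondition. *)
Definition runs (o : oracle) (c : program) (st : store) (Q : store -> Prop) : Prop :=
  exists2 st', exec o c st st' & Q st'.

Section Runs.
Variable o : oracle.

Lemma runs_weaken c st (Q Q' : store -> Prop) :
  runs o c st Q -> (forall st', Q st' -> Q' st') -> runs o c st Q'.
Proof. by move=> [st' ex Qst'] QQ'; exists st'; last exact: QQ'. Qed.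

Lemma runs_assign x e st (Q : store -> Prop) :
  Q (update st x (Defs.eval st e)) -> runs o (Assign x e) st Q.
Proof. by exists (update st x (Defs.eval st e)) => //; constructor. Qed.

Lemma runs_query x y j n (kj kn : nat) st (Q : store -> Prop) :
  Defs.eval st j = kj%:R -> Defs.eval st n = kn%:R ->
  Q (update (update st x (o kj kn).1) y (o kj kn).2) -> runs o (Query x y j n) st Q.
Proof.
move=> jE nE Qst; eexists; first by constructor.
by rewrite jE nE !natrK.
Qed.

Lemma runs_seq c1 c2 st (Q : store -> Prop) :
  runs o c1 st (fun st' => runs o c2 st' Q) -> runs o (Seq c1 c2) st Q.
Proof. by move=> [st1 ex1 [st2 ex2 Qst2]]; exists st2 => //; apply: ExecSeq ex1 ex2. Qed.

(** For loops whose number K of iterations is known in advance; I i describes the store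
    after i of them. *)
Lemma runs_loop (I : nat -> store -> Prop) (K : nat) e c st (Q : store -> Prop) :
  I 0%N st ->
  (forall i st, (i < K)%N -> I i st -> 0 < Defs.eval st e /\ runs o c st (I i.+1)) ->
  (forall st, I K st -> Defs.eval st e <= 0 /\ Q st) ->
  runs o (WhilePos e c) st Q.
Proof.
move=> I0 step stop.
have loop k : forall i st, (i + k = K)%N -> I i st -> runs o (WhilePos e c) st Q.
  elim: k => [|k IH] i st' iK Ii.
    have [e0 Qst] : Defs.eval st' e <= 0 /\ Q st' by apply: stop; rewrite -iK addn0.
    by exists st' => //; apply: ExecWhileStop.
  have iltK : (i < K)%N by rewrite -iK -[X in (X < _)%N]addn0 ltn_add2l.
  have [e0 [st1 ex1 Ii1]] := step i st' iltK Ii.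
  have [|st2 ex2 Qst2] := IH i.+1 st1 _ Ii1; first by rewrite addSnnS.
  by exists st2 => //; apply: ExecWhileStep ex1 ex2.
exact: (loop K 0%N).
Qed.

End Runs.

Definition agree (k : nat) (st st' : store) : Prop :=
  forall r, (r < k)%N -> st' r = st r.

Lemma agree_update k st st' x a :
  (k <= x)%N -> agree k st st' -> agree k st (update st' x a).
Proof.
by move=> kx ag r rk; rewrite /update ltn_eqF ?ag // (leq_trans rk).
Qed.

Definition Sub (e1 e2 : expr) : expr := Add e1 (Opp e2).
Definition Nat (k : nat) : expr := Const k%:R.

(** An error of 2 * 2^-(n + d + 2) in each coefficient, weighted by binomial coefficients
    of sum 2^d, amounts to 2^-(n + 1). *)
Definition precision : expr := Add (Add (Reg 1) (Reg 0)) (Nat 2).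

Definition next_term : program :=
  Seq (Assign 11 (Mul (Mul (Reg 11) (Sub (Reg 0) (Reg 10)))
                      (Defs.Inv (Add (Reg 10) (Nat 1)))))
      (Assign 10 (Add (Reg 10) (Nat 1))).

(** Registers 0 and 1 hold d and n throughout.  The counter j is in register 10, the
    binomial coefficient C(d, j) in register 11 and the approximation of s_j in registers
    12 and 13. *)
Definition for_each_entry (init body : program) : program :=
  Seq (Assign 10 (Nat 0)) (Seq (Assign 11 (Nat 1)) (Seq init
    (WhilePos (Sub (Add (Reg 0) (Nat 1)) (Reg 10))
       (Seq (Query 12 13 (Reg 10) precision) (Seq body next_term))))).


Section EntryLoop.
Variables (o : oracle) (d n : nat).

Definition at_entry (j : nat) (st : store) : Prop :=
  [/\ st 0%N = d%:R, st 1%N = n%:R, st 10%N = j%:R & st 11%N = 'C(d, j)%:R].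

Definition answer (j : nat) : rat * rat := o j (n + d + 2).

Lemma runs_for_each_entry (J : nat -> store -> Prop) init body st (Q : store -> Prop) :
  runs o init (update (update st 10 0) 11 1) (fun st' => at_entry 0 st' /\ J 0%N st') ->
  (forall j st, (j <= d)%N -> at_entry j st -> J j st ->
     runs o body (update (update st 12 (answer j).1) 13 (answer j).2)
       (fun st' => at_entry j st' /\
          forall a b, J j.+1 (update (update st' 11 a) 10 b))) ->
  (forall st, J d.+1 st -> Q st) ->
  runs o (for_each_entry init body) st Q.
Proof.
move=> init_ok body_ok stop.
apply: runs_seq; apply: runs_assign; apply: runs_seq; apply: runs_assign.
apply: runs_seq; apply: runs_weaken init_ok _ => st0 J0.
apply: (runs_loop (I := fun j st => at_entry j st /\ J j st) (K := d.+1)) J0 _ _.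
  move=> j st1 jd [[s0 s1 s10 s11] Jst]; split.
    by rewrite /= s0 s10 natr1 subr_gt0 ltr_nat.
  apply: runs_seq; apply: (runs_query (kj := j) (kn := (n + d + 2)%N)) => //.
    by rewrite /= s0 s1 !natrD.
  apply: runs_seq; apply: runs_weaken (body_ok _ _ _ _ Jst) _ => //.
  move=> st2 [[t0 t1 t10 t11] Jst2].
  apply: runs_seq; apply: runs_assign; apply: runs_assign; split; last exact: Jst2.
  split=> //; rewrite /update /=; first by rewrite t10 natr1.
  by rewrite t0 t10 t11 natr1 -natrB // -natrM mulnC -mul_bin_left natrM mulrC mulKf //.
move=> st3 [[s0 _ s10 _] Jst]; split; last exact: stop.
by rewrite /= s0 s10 natr1 subrr.
Qed.

End EntryLoop.

(** Register 2 receives an upper bound of n + 4 d L, where L is the sum of the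
    C(d, j) |s_j|; the term a^2 + b^2 + 3 bounds the modulus of a number with
    approximation a + ib. *)
Definition compute_bound : program :=
  for_each_entry (Assign 2 (Reg 1))
    (Assign 2 (Add (Reg 2) (Mul (Mul (Mul (Nat 4) (Reg 0)) (Reg 11))
      (Add (Add (Mul (Reg 12) (Reg 12)) (Mul (Reg 13) (Reg 13))) (Nat 3))))).

(** The grid step, in register 3, is 2^-K for the least natural number K not below the
    bound in register 2.  Since m <= 2^m, this makes 2 d L 2^-K at most 2^-(n + 1). *)
Definition compute_step : program :=
  Seq (Assign 3 (Nat 1)) (Seq (Assign 10 (Nat 0))
    (WhilePos (Sub (Reg 2) (Reg 10))
      (Seq (Assign 3 (Mul (Reg 3) (Const (2^-1)))) (Assign 10 (Add (Reg 10) (Nat 1)))))).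

(** A Horner scheme for the form with approximate coefficients at the point whose two
    complex coordinates are in registers 5 to 8.  Registers 14 and 15 hold the partial sum
    of the terms C(d, i) s_i x_1^(j - 1 - i) x_2^i for i < j, registers 16 and 17 the power
    x_2^j, and register 18 is temporary. *)
Definition compute_form : program :=
  for_each_entry
    (Seq (Assign 14 (Nat 0)) (Seq (Assign 15 (Nat 0))
    (Seq (Assign 16 (Nat 1)) (Assign 17 (Nat 0)))))
    (Seq (Assign 18 (Add (Sub (Mul (Reg 14) (Reg 5)) (Mul (Reg 15) (Reg 6)))
            (Mul (Reg 11) (Sub (Mul (Reg 12) (Reg 16)) (Mul (Reg 13) (Reg 17))))))
    (Seq (Assign 15 (Add (Add (Mul (Reg 14) (Reg 6)) (Mul (Reg 15) (Reg 5)))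
            (Mul (Reg 11) (Add (Mul (Reg 12) (Reg 17)) (Mul (Reg 13) (Reg 16))))))
    (Seq (Assign 14 (Reg 18))
    (Seq (Assign 18 (Sub (Mul (Reg 16) (Reg 7)) (Mul (Reg 17) (Reg 8))))
    (Seq (Assign 17 (Add (Mul (Reg 16) (Reg 8)) (Mul (Reg 17) (Reg 7))))
         (Assign 16 (Reg 18))))))).

Definition norm2_expr : expr :=
  Add (Add (Mul (Reg 5) (Reg 5)) (Mul (Reg 6) (Reg 6)))
      (Add (Mul (Reg 7) (Reg 7)) (Mul (Reg 8) (Reg 8))).

(** Register 4 holds the largest real part found so far.  The loop on register 9 is a
    conditional: it is entered only at points of the open unit ball, and its body resets
    the register. *)
Definition update_best : program :=
  Seq (Assign 9 (Sub (Nat 1) norm2_expr))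
    (WhilePos (Reg 9)
      (Seq compute_form
        (Seq (WhilePos (Sub (Reg 14) (Reg 4)) (Assign 4 (Reg 14)))
             (Assign 9 (Nat 0))))).

Definition grid_loop (r : nat) (c : program) : program :=
  Seq (Assign r (Const (-1)))
    (WhilePos (Sub (Add (Nat 1) (Reg 3)) (Reg r))
      (Seq c (Assign r (Add (Reg r) (Reg 3))))).

Definition spectral_norm_program : program :=
  Seq compute_bound (Seq compute_step (Seq (Assign 4 (Nat 0))
    (Seq (grid_loop 5 (grid_loop 6 (grid_loop 7 (grid_loop 8 update_best))))
         (Assign 0 (Reg 4))))).

Section Specs.
Variables (o : oracle) (d n : nat).

Definition rat_bound (i : nat) : rat :=
  n%:R + \sum_(j < i) 4 * d%:R * 'C(d, j)%:R *
    ((answer o d n j).1 ^+ 2 + (answer o d n j).2 ^+ 2 + 3).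

Lemma runs_compute_bound st (Q : store -> Prop) :
  st 0%N = d%:R -> st 1%N = n%:R ->
  (forall st', [/\ st' 0%N = d%:R, st' 1%N = n%:R & st' 2%N = rat_bound d.+1] -> Q st') ->
  runs o compute_bound st Q.
Proof.
move=> st0 st1 post.
apply: (runs_for_each_entry (d := d) (n := n)
  (J := fun i st => [/\ st 0%N = d%:R, st 1%N = n%:R & st 2%N = rat_bound i])) => //.
  apply: runs_assign; split; split; rewrite /update //= ?bin0 //.
  by rewrite /rat_bound big_ord0 addr0 st1.
move=> j st2 jd [s0 s1 s10 s11] [_ _ s2]; apply: runs_assign; split.
  by split.
move=> a b; split=> //; rewrite /update /= s0 s2 s11 /rat_bound big_ord_recr /=.
by rewrite -addrA -!expr2.
Qed.

Lemma runs_compute_step st (B : rat) (K : nat) (Q : store -> Prop) :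
  st 0%N = d%:R -> st 1%N = n%:R -> st 2%N = B ->
  (forall i : nat, (i < K)%N = (i%:R < B)) ->
  (forall st', [/\ st' 0%N = d%:R, st' 1%N = n%:R & st' 3%N = 2 ^- K] -> Q st') ->
  runs o compute_step st Q.
Proof.
move=> st0 st1 st2 KB post.
do 2 (apply: runs_seq; apply: runs_assign).
apply: (runs_loop (K := K) (I := fun i st => [/\ st 0%N = d%:R, st 1%N = n%:R, st 2%N = B,
   st 3%N = 2 ^- i & st 10%N = i%:R])).
- by split=> //; rewrite expr0 invr1.
- move=> i st3 iK [s0 s1 s2 s3 s10]; split; first by rewrite /= s2 s10 subr_gt0 -KB.
  apply: runs_seq; apply: runs_assign; apply: runs_assign; split=> //; rewrite /update /=.
    by rewrite s3 exprSr invfM mulrC.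
  by rewrite s10 natr1.
move=> st3 [s0 s1 s2 s3 s10]; split; last exact: post.
by rewrite /= s2 s10 subr_le0 leNgt -KB ltnn.
Qed.

End Specs.

Lemma runs_once o e c st (Q : store -> Prop) :
  (0 < Defs.eval st e -> runs o c st (fun st' => Defs.eval st' e <= 0 /\ Q st')) ->
  (Defs.eval st e <= 0 -> Q st) ->
  runs o (WhilePos e c) st Q.
Proof.
have [e0 _ /(_ isT) Qst|e0 /(_ isT) [st1 ex1 [e1 Qst1]] _] := leP (Defs.eval st e) 0.
  by exists st => //; apply: ExecWhileStop.
by exists st1 => //; apply: ExecWhileStep ex1 _ => //; apply: ExecWhileStop.
Qed.

Section Gauss.
Variable R : realType.
Local Notation C := R[i].

Definition gauss (x y : rat) : C := ratr x +i* ratr y.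

Lemma gaussD x y z t : gauss x y + gauss z t = gauss (x + z) (y + t).
Proof. by rewrite /gauss !rmorphD. Qed.

Lemma gaussM x y z t :
  gauss x y * gauss z t = gauss (x * z - y * t) (x * t + y * z).
Proof. by rewrite /gauss rmorphB rmorphD !rmorphM. Qed.

Lemma gaussMn x y m : gauss x y *+ m = gauss (m%:R * x) (m%:R * y).
Proof.
elim: m => [|m IH]; first by rewrite mulr0n !mul0r /gauss rmorph0.
by rewrite mulrSr IH gaussD -natr1 !mulrDl !mul1r.
Qed.

Lemma normc_gauss x y : normc (gauss x y) ^+ 2 = ratr (x ^+ 2 + y ^+ 2).
Proof. by rewrite normc_sqr /= rmorphD !rmorphXn. Qed.

Section Form.
Variables (o : oracle) (d n : nat).

Definition approx_entry (j : nat) : C := gauss (answer o d n j).1 (answer o d n j).2.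

Definition approx_form (a b : C) : C :=
  \sum_(j < d.+1) (approx_entry j *+ 'C(d, j)) * (a ^+ (d - j) * b ^+ j).

Lemma runs_compute_form st (Q : store -> Prop) :
  st 0%N = d%:R -> st 1%N = n%:R ->
  (forall st', agree 10 st st' ->
     gauss (st' 14%N) (st' 15%N) =
       approx_form (gauss (st 5%N) (st 6%N)) (gauss (st 7%N) (st 8%N)) -> Q st') ->
  runs o compute_form st Q.
Proof.
move=> st0 st1 post.
set a := gauss (st 5%N) (st 6%N) in post *; set b := gauss (st 7%N) (st 8%N) in post *.
pose partial (i : nat) : C :=
  \sum_(j < i) (approx_entry j *+ 'C(d, j)) * (a ^+ (i.-1 - j) * b ^+ j).
have partialS i : partial i.+1 = partial i * a + (approx_entry i *+ 'C(d, i)) * b ^+ i.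
  rewrite /partial big_ord_recr /= subnn expr0 mul1r mulr_suml; congr (_ + _).
  apply: eq_bigr => j _; have -> : (i - j)%N = (i.-1 - j).+1.
    by case: i j => [|i] j; [case: j | rewrite /= subSn // -ltnS].
  by rewrite exprSr -!mulrA [a * _]mulrC.
apply: (runs_for_each_entry (d := d) (n := n) (J := fun i st' => [/\ agree 10 st st',
    gauss (st' 14%N) (st' 15%N) = partial i & gauss (st' 16%N) (st' 17%N) = b ^+ i])).
- do 3 (apply: runs_seq; apply: runs_assign); apply: runs_assign.
  split; first by split; rewrite /update /= ?bin0.
  split; first by do 6 (apply: agree_update => //).
    by rewrite /partial big_ord0 /gauss /= rmorph0.
  by rewrite expr0 /gauss /update /= rmorph0 rmorph1.
- move=> j st2 jd [s0 s1 s10 s11] [ag acc pow].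
  do 5 (apply: runs_seq; apply: runs_assign); apply: runs_assign.
  split; first by split.
  move=> x y; split; first by do 10 (apply: agree_update => //).
    rewrite partialS -acc -pow /a /approx_entry gaussMn !gaussM gaussD /update /=.
    by rewrite s11 !(ag 5%N, ag 6%N) //; congr gauss; ring.
  by rewrite exprSr -pow /b gaussM /update /= !(ag 7%N, ag 8%N) //; congr gauss; ring.
by move=> st' [ag acc _]; apply: post.
Qed.

Section Grid.
Variables (h : rat) (U : R).
Hypothesis U_bound : forall a b : C, normc a ^+ 2 + normc b ^+ 2 < 1 ->
  complex.Re (approx_form a b) <= U.

Definition agree_but_best (k : nat) (st st' : store) : Prop :=
  forall r, (r < k)%N -> r != 4%N -> st' r = st r.

Definition good (st : store) : Prop :=
  [/\ st 0%N = d%:R, st 1%N = n%:R, st 3%N = h & ratr (st 4%N) <= U].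

(** An invariant that passes through nested loops: besides keeping the store good, c may
    only raise the best value, and it makes that value satisfy P, a condition that
    depends on the registers below k and is stable when the best value is raised. *)
Definition improves (k : nat) (c : program) (P : store -> rat -> Prop) : Prop :=
  [/\ forall st st' b, agree_but_best k st st' -> P st b -> P st' b,
      forall st b b', b <= b' -> P st b -> P st b' &
      forall st, good st -> runs o c st (fun st' =>
        [/\ good st', st 4%N <= st' 4%N, agree_but_best k st st' & P st (st' 4%N)])].

Definition beats (x1 x2 x3 x4 best : rat) : Prop :=
  x1 ^+ 2 + x2 ^+ 2 + (x3 ^+ 2 + x4 ^+ 2) < 1 ->
  complex.Re (approx_form (gauss x1 x2) (gauss x3 x4)) <= ratr best.

Lemma improves_update_best : improves 9 update_best
  (fun st best => beats (st 5%N) (st 6%N) (st 7%N) (st 8%N) best).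
Proof.
split.
- by move=> st st' b ag; rewrite !ag.
- by move=> st b b' bb' Pb lt; apply: le_trans (Pb lt) _; rewrite ler_rat.
move=> st [s0 s1 s3 s4]; apply: runs_seq; apply: runs_assign.
set nrm := Defs.eval st _.
have nrmE : nrm = 1 - (st 5%N ^+ 2 + st 6%N ^+ 2 + (st 7%N ^+ 2 + st 8%N ^+ 2)).
  by rewrite /nrm /= !expr2.
apply: runs_once => /= [lt1|ge1]; last first.
  split=> //; first by move=> r r9 _; rewrite /update ltn_eqF.
  by move: ge1; rewrite /update /= nrmE subr_le0 => ge1; rewrite /beats ltNge ge1.
have {}lt1 : st 5%N ^+ 2 + st 6%N ^+ 2 + (st 7%N ^+ 2 + st 8%N ^+ 2) < 1.
  by move: lt1; rewrite /update /= nrmE subr_gt0.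
apply: runs_seq; apply: runs_compute_form => // st1 ag.
rewrite /update /=; set f := approx_form _ _ => fE.
have fU : complex.Re f <= U.
  by apply: U_bound; rewrite !normc_gauss -rmorphD /= -(ltr_rat R) rmorph1 in lt1 *.
have f14 : complex.Re f = ratr (st1 14%N) by rewrite -fE.
have ag' r : (r < 9)%N -> st1 r = st r.
  by move=> r9; rewrite ag ?(leq_trans r9) // /update ltn_eqF.
apply: runs_seq; apply: runs_once => /= [gt|le].
  apply: runs_assign; split; first by rewrite /update /= subrr.
  apply: runs_assign; split=> //; split.
  - by split; rewrite /update /= ?(ag' 0%N, ag' 1%N, ag' 3%N) // -f14.
  - by move: gt; rewrite subr_gt0 (ag' 4%N) // => /ltW.
  - by move=> r r9 r4; rewrite /update (ltn_eqF r9) (negPf r4) ag'.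
  by move=> _; rewrite /update /= -f14.
apply: runs_assign; split=> //; split.
- by split; rewrite /update /= ag'.
- by rewrite /update /= ag'.
- by move=> r r9 r4; rewrite /update (ltn_eqF r9) ag'.
move=> _; rewrite /update /= -/f f14 ler_rat.
by move: le; rewrite subr_le0.
Qed.

Variable N : nat.
Hypothesis N_points : forall i : nat, (i < N)%N = (i%:R * h < 2 + h).

Definition grid_point (i : nat) : rat := -1 + i%:R * h.

(** The goal of the loop over register k quantifies over the values of that register, so
    it depends on one register less; nesting the lemma four times quantifies over the
    whole grid. *)
Lemma improves_grid_loop k c P : (4 < k)%N -> improves k.+1 c P ->
  improves k (grid_loop k c) (fun st best =>
    forall i, (i < N)%N -> P (update st k (grid_point i)) best).
Proof.
move=> k4 [ext mono ok].
have agS st st' x : agree_but_best k st st' ->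
    agree_but_best k.+1 (update st k x) (update st' k x).
  move=> ag r; rewrite ltnS leq_eqVlt /update; case: eqP => //= _ rk r4.
  exact: ag.
split.
- by move=> st st' b ag Pst i iN; apply: ext (agS _ _ _ ag) (Pst i iN).
- by move=> st b b' bb' Pst i iN; apply: mono bb' (Pst i iN).
have reg r : (r < 5)%N -> (r == k) = false.
  by move=> r5; rewrite ltn_eqF // (leq_trans r5).
have goodU st x : good st -> good (update st k x).
  by move=> [s0 s1 s3 s4]; split; rewrite /update reg.
move=> st gst; apply: runs_seq; apply: runs_assign.
apply: (runs_loop (K := N) (I := fun i st' => [/\ good st', st' k = grid_point i,
   st 4%N <= st' 4%N, agree_but_best k st st' &
   forall i', (i' < i)%N -> P (update st k (grid_point i')) (st' 4%N)])).
- split=> //=; first exact: goodU.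
  + by rewrite /update eqxx /grid_point mul0r addr0.
  + by rewrite /update reg.
  by move=> r rk _; rewrite /update (ltn_eqF rk).
- move=> i st1 iN [g1 k1 b1 ag1 P1]; split.
    have [_ _ s3 _] := g1; rewrite /= s3 k1 /grid_point.
    by move: iN; rewrite N_points => iN; lra.
  apply: runs_seq; apply: runs_weaken (ok _ g1) _ => st2 [g2 b2 ag2 P2].
  apply: runs_assign; split.
  + exact: goodU.
  + have [_ _ s3 _] := g2; rewrite /update eqxx /= s3 ag2 // ?k1; last by rewrite gtn_eqF.
    by rewrite /grid_point -natr1 mulrDl mul1r addrA.
  + by rewrite /update reg // (le_trans b1).
  + by move=> r rk r4; rewrite /update (ltn_eqF rk) ag2 ?ag1 // ltnW.
  move=> i'; rewrite {2}/update reg // ltnS leq_eqVlt => /orP[/eqP ->|ii'].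
    apply: ext P2 => r rk r4; rewrite /update; case: eqP => [->|/eqP rk'] //.
    by rewrite ag1 // ltn_neqAle rk' -ltnS.
  by apply: mono b2 _; apply: P1.
move=> st1 [g1 k1 b1 ag1 P1]; split; last by split.
have [_ _ s3 _] := g1; rewrite /= s3 k1 /grid_point.
by have := N_points N; rewrite ltnn => /esym /negbT; rewrite -leNgt => le; lra.
Qed.

Lemma runs_grid st (Q : store -> Prop) : good st ->
  (forall st', ratr (st' 4%N) <= U ->
     (forall i1 i2 i3 i4, (i1 < N)%N -> (i2 < N)%N -> (i3 < N)%N -> (i4 < N)%N ->
        beats (grid_point i1) (grid_point i2) (grid_point i3) (grid_point i4) (st' 4%N)) ->
     Q st') ->
  runs o (grid_loop 5 (grid_loop 6 (grid_loop 7 (grid_loop 8 update_best)))) st Q.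
Proof.
move=> gst post.
have [_ _ /(_ _ gst) ok] := improves_grid_loop (k := 5) isT (improves_grid_loop (k := 6) isT
  (improves_grid_loop (k := 7) isT (improves_grid_loop (k := 8) isT improves_update_best))).
apply: runs_weaken ok _ => st' [[_ _ _ le] _ _ better]; apply: post => //.
by move=> i1 i2 i3 i4 N1 N2 N3 N4; apply: better N1 _ N2 _ N3 _ N4.
Qed.

End Grid.
End Form.
End Gauss.

(** * Error estimates *)

Section Norms.
Variable R : realType.
Local Notation C := R[i].

Lemma normcD (x y : C) : normc (x + y) <= normc x + normc y.
Proof. exact: le_normcD. Qed.

Lemma normc_sum (I : Type) (r : seq I) (F : I -> C) :
  normc (\sum_(i <- r) F i) <= \sum_(i <- r) normc (F i).
Proof.
elim/big_ind2: _ => // [|x1 x2 y1 y2 le1 le2]; first by rewrite normc0.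
by apply: le_trans (normcD _ _) _; apply: lerD.
Qed.

Lemma normc_nat m : normc (m%:R : C) = m%:R.
Proof. by rewrite -(rmorph_nat (real_complex R)) normc_real normr_nat. Qed.

Lemma normc_Mn (x : C) m : normc (x *+ m) = normc x * m%:R.
Proof. by rewrite -[x *+ m]mulr_natr normcM normc_nat. Qed.

Lemma Re_le_normc (x : C) : `|complex.Re x| <= normc x.
Proof. by rewrite -lecR normc_ge_Re. Qed.

Lemma normc_le_ReIm (x : C) : normc x <= `|complex.Re x| + `|complex.Im x|.
Proof.
rewrite -(@ler_pXn2r _ 2) ?nnegrE ?normc_ge0 ?addr_ge0 // normc_sqr sqrrD.
rewrite !real_normK ?num_real // lerD2r lerDl mulrn_wge0 // mulr_ge0 //.
Qed.

Lemma pow_diff_le (a a' : C) (e : R) m : normc a <= 1 -> normc a' <= 1 ->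
  normc (a - a') <= e -> normc (a ^+ m - a' ^+ m) <= m%:R * e.
Proof.
move=> a1 a1' aa'; elim: m => [|m IH].
  by rewrite !expr0 subrr normc0 mul0r.
have -> : a ^+ m.+1 - a' ^+ m.+1 = a * (a ^+ m - a' ^+ m) + (a - a') * a' ^+ m.
  by rewrite !exprS; ring.
apply: le_trans (normcD _ _) _; rewrite -natr1 [_ * e]mulrDl mul1r !normcM normcX.
apply: lerD.
  by apply: le_trans IH; rewrite ler_piMl ?normc_ge0.
by apply: le_trans aa'; rewrite ler_piMr ?normc_ge0 // exprn_ile1 ?normc_ge0.
Qed.

(** All factors lie in the unit disc, so replacing them one at a time costs at most e
    each. *)
Lemma monomial_diff_le (a a' b b' : C) (e : R) m k :
  normc a <= 1 -> normc a' <= 1 -> normc b <= 1 -> normc b' <= 1 ->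
  normc (a - a') <= e -> normc (b - b') <= e ->
  normc (a ^+ m * b ^+ k - a' ^+ m * b' ^+ k) <= (m + k)%:R * e.
Proof.
move=> a1 a1' b1 b1' aa' bb'.
have -> : a ^+ m * b ^+ k - a' ^+ m * b' ^+ k =
    (a ^+ m - a' ^+ m) * b' ^+ k + a ^+ m * (b ^+ k - b' ^+ k) by ring.
apply: le_trans (normcD _ _) _; rewrite natrD [_ * e]mulrDl !normcM !normcX.
apply: lerD.
  apply: le_trans (pow_diff_le m a1 a1' aa').
  by rewrite ler_piMr ?normc_ge0 // exprn_ile1 ?normc_ge0.
apply: le_trans (pow_diff_le k b1 b1' bb').
by rewrite ler_piMl ?normc_ge0 // exprn_ile1 ?normc_ge0.
Qed.

Section Form.
Variables (d : nat) (s : 'cV[C]_d.+1).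

Definition coef_mass : R := \sum_(j < d.+1) normc (entry s j) * 'C(d, j)%:R.

Lemma binary_form_lipschitz (a a' b b' : C) (e : R) :
  normc a <= 1 -> normc a' <= 1 -> normc b <= 1 -> normc b' <= 1 ->
  normc (a - a') <= e -> normc (b - b') <= e ->
  normc (binary_form s a b - binary_form s a' b') <= coef_mass * (d%:R * e).
Proof.
move=> a1 a1' b1 b1' aa' bb'; rewrite /binary_form -sumrB /coef_mass mulr_suml.
apply: le_trans (normc_sum _ _) _; apply: ler_sum => j _.
rewrite -mulrBr normcM normc_Mn ler_wpM2l ?mulr_ge0 ?normc_ge0 ?ler0n //.
have jd : (j <= d)%N by rewrite -ltnS.
by have := monomial_diff_le (d - j) j a1 a1' b1 b1' aa' bb'; rewrite subnK.
Qed.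

Lemma binary_form_scale (c a b : C) :
  binary_form s (c * a) (c * b) = c ^+ d * binary_form s a b.
Proof.
rewrite /binary_form mulr_sumr; apply: eq_bigr => j _.
have jd : (j <= d)%N by rewrite -ltnS.
have -> : c ^+ d = c ^+ (d - j) * c ^+ j by rewrite -exprD subnK.
by rewrite !exprMn; ring.
Qed.

Variable S : tensor R d.
Hypotheses (d0 : (0 < d)%N) (Ss : associated S s).
Local Notation nu := (spectral_norm BaseC S).

Lemma spectral_norm_ge0 : 0 <= nu.
Proof. exact: le_trans (normc_ge0 _) (entry_le_spectral_norm Ss BaseC). Qed.

Lemma binary_form_le_norm (a b : C) : normc a ^+ 2 + normc b ^+ 2 <= 1 ->
  normc (binary_form s a b) <= nu.
Proof.
move=> ab1; pose rho := Num.sqrt (normc a ^+ 2 + normc b ^+ 2).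
have ge0 : 0 <= normc a ^+ 2 + normc b ^+ 2 by rewrite addr_ge0 ?sqr_ge0.
have [r0|r0] := eqVneq rho 0.
  move/eqP: r0; rewrite sqrtr_eq0 => le0.
  have : normc a ^+ 2 + normc b ^+ 2 == 0 by rewrite eq_le le0 ge0.
  rewrite paddr_eq0 ?sqr_ge0 // !sqrf_eq0 => /andP[].
  move=> /eqP /eq0_normc -> /eqP /eq0_normc ->.
  by rewrite binary_form_infty expr0n gtn_eqF // mulr0 normc0 spectral_norm_ge0.
have rC : rho%:C != 0 by apply: contra_neq r0 => /(@complexI _ rho 0).
have rho_gt0 : 0 < rho by rewrite lt0r r0 sqrtr_ge0.
have aE : a = rho%:C * (a / rho%:C) by rewrite mulrC divfK.
have bE : b = rho%:C * (b / rho%:C) by rewrite mulrC divfK.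
rewrite aE bE binary_form_scale normcM normcX normc_real gtr0_norm //.
apply: (@le_trans _ _ (normc (binary_form s (a / rho%:C) (b / rho%:C)))).
  rewrite ler_piMl ?normc_ge0 // exprn_ile1 ?(ltW rho_gt0) //.
  by have : rho <= Num.sqrt 1; [rewrite /rho ler_sqrt | rewrite sqrtr1].
apply: spectral_norm_values; exists (vec2 (a / rho%:C) (b / rho%:C)); last first.
  by rewrite (tensor_eval_form Ss) vec2_0 vec2_1.
split=> //; apply/l2norm_unit; rewrite vec2_0 vec2_1 !normcM.
rewrite normcV normc_real gtr0_norm // !exprMn -mulrDl.
by rewrite -[X in X * _]sqr_sqrtr // -/rho -exprMn divff // expr1n.
Qed.

(** A d-th root of unit modulus, since f (w x) = w^d f x. *)
Lemma exists_phase (z : C) : exists2 w : C, normc w = 1 & w ^+ d * z = (normc z)%:C.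
Proof.
have [->|z0] := eqVneq z 0.
  by exists 1; rewrite ?normc1 // mulr0 normc0.
pose y := `|z| / z; have yE : (d.-root y) ^+ d = y by rewrite rootCK.
have zn : `|z| != 0 by rewrite normr_eq0.
exists (d.-root y); last by rewrite yE /y divfK.
have : normc (d.-root y) ^+ d = 1.
  apply: (@complexI R); rewrite -normcX yE -norm_normc /y normrM normr_id.
  by rewrite normfV divff.
by move/eqP; rewrite pexpr_eq1 ?normc_ge0 -?lt0n // => /eqP.
Qed.

Lemma exists_real_maximizer : exists a b : C,
  normc a ^+ 2 + normc b ^+ 2 = 1 /\ binary_form s a b = nu%:C.
Proof.
have [[x [_ /l2norm_unit x1] xE] _] := spectral_norm_max BaseC S.
have [w w1 wE] := exists_phase (tensor_eval S x).
exists (w * x 0 0), (w * x 1 0); rewrite !normcM w1 !mul1r; split=> //.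
by rewrite binary_form_scale -(tensor_eval_form Ss) wE xE.
Qed.

Section Approx.
Variables (o : oracle) (n : nat).
Hypothesis os : approximates o s.

Lemma approx_entry_error j : (j <= d)%N ->
  normc (approx_entry R o d n j - entry s j) <= 2 * 2 ^- (n + d + 2).
Proof.
move=> jd; have [re im] := os (n + d + 2) jd.
apply: le_trans (normc_le_ReIm _) _; rewrite mulr2n mulrDl !mul1r.
rewrite /approx_entry /gauss /answer.
case: (entry s j) re im => x y /= re im.
by apply: lerD; rewrite distrC.
Qed.

Lemma entry_le_approx j : (j <= d)%N ->
  normc (entry s j) <= ratr ((answer o d n j).1 ^+ 2 + (answer o d n j).2 ^+ 2 + 3).
Proof.
move=> jd; have [re im] := os (n + d + 2) jd.
have e1 : 2 ^- (n + d + 2) <= 1 :> R.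
  by rewrite invf_le1 ?exprn_gt0 // exprn_ege1 // ler1n.
apply: le_trans (normc_le_ReIm _) _; rewrite 2!rmorphD !rmorphXn /= ratr_nat /answer.
move: re im e1; set x := complex.Re _; set y := complex.Im _.
set x' : R := ratr _; set y' : R := ratr _; set e := 2 ^- _ => re im e1.
have : `|x| <= `|x'| + e by rewrite -(subrK x' x) addrC (le_trans (ler_normD _ _)) // lerD2l.
have : `|y| <= `|y'| + e by rewrite -(subrK y' y) addrC (le_trans (ler_normD _ _)) // lerD2l.
have sq t : `|t| <= t ^+ 2 + 4^-1 :> R.
  by rewrite -(real_normK (num_real t)); have := sqr_ge0 (`|t| - 2^-1); lra.
by have := sq x'; have := sq y'; lra.
Qed.

Lemma coef_mass_le : n%:R + 4 * d%:R * coef_mass <= ratr (rat_bound o d n d.+1).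
Proof.
rewrite /rat_bound rmorphD rmorph_nat lerD2l rmorph_sum /= /coef_mass mulr_sumr.
apply: ler_sum => j _; have jd : (j <= d)%N by rewrite -ltnS.
rewrite !rmorphM !rmorph_nat /= -!mulrA ler_wpM2l // ler_wpM2l // mulrC ler_wpM2l //.
exact: entry_le_approx.
Qed.

Lemma approx_form_error (a b : C) : normc a <= 1 -> normc b <= 1 ->
  normc (approx_form o d n a b - binary_form s a b) <= 2 ^- n.+1.
Proof.
move=> a1 b1; rewrite /approx_form /binary_form -sumrB.
apply: le_trans (normc_sum _ _) _.
have -> : 2 ^- n.+1 = \sum_(j < d.+1) 2 * 2 ^- (n + d + 2) * 'C(d, j)%:R :> R.
  rewrite -mulr_sumr -natr_sum.
  have -> : (\sum_(j < d.+1) 'C(d, j) = 2 ^ d)%N.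
    by rewrite (expnDn 1 1); apply: eq_bigr => j _; rewrite !exp1n !muln1.
  rewrite natrX !exprD exprS; field.
  by rewrite !expf_neq0.
apply: ler_sum => j _; have jd : (j <= d)%N by rewrite -ltnS.
rewrite -mulrBl -mulrnBl normcM normc_Mn.
apply: (@le_trans _ _ (normc (approx_entry R o d n j - entry s j) * 'C(d, j)%:R)).
  rewrite ler_piMr ?mulr_ge0 ?normc_ge0 // normcM !normcX.
  by rewrite mulr_ile1 ?exprn_ge0 ?normc_ge0 // exprn_ile1 ?normc_ge0.
by rewrite ler_wpM2r // approx_entry_error.
Qed.

End Approx.
End Form.
End Norms.

(** * Correctness of the program *)

Lemma ceil_nat (B : rat) : exists K : nat, forall i : nat, (i < K)%N = (i%:R < B).
Proof.
have exK : exists K : nat, B <= K%:R.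
  by exists (Num.truncn B).+1; rewrite ltW // truncnS_gt.
have [K BK Kmin] := ex_minnP exK; exists K => i.
have [iK|Ki] := ltnP i K.
  by apply/esym; rewrite ltNge; apply/negP => /Kmin; rewrite leqNgt iK.
by apply/esym/negbTE; rewrite -leNgt (le_trans BK) // ler_nat.
Qed.

Section Rounding.
Variables (R : realType) (K : nat).
Let h : rat := 2 ^- K.
Let point (i : nat) : R := ratr (grid_point h i).

Lemma grid_point_count (i : nat) : (i < (2 * 2 ^ K).+1)%N = (i%:R * h < 2 + h).
Proof.
have M0 : 0 < 2 ^+ K :> rat by rewrite exprn_gt0.
rewrite -(ltr_pM2r M0) mulrDl /h divfK ?mulVf ?gt_eqF //.
by rewrite -natrX -natrM natr1 ltr_nat.
Qed.

(** Rounding towards 0, and strictly so unless y = 0, moves a unit vector into the open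
    unit ball. *)
Lemma round_to_grid (y : R) : `|y| <= 1 ->
  exists i, [/\ (i < (2 * 2 ^ K).+1)%N, `|y - point i| <= 2 ^- K,
    point i ^+ 2 <= y ^+ 2 & y != 0 -> point i ^+ 2 < y ^+ 2].
Proof.
move=> y1; pose M : R := 2 ^+ K.
have M0 : 0 < M by rewrite exprn_gt0.
have MN : M = (2 ^ K)%:R by rewrite natrX.
have pointE i : point i = -1 + i%:R / M.
  by rewrite /point /grid_point /h rmorphD rmorphN rmorph1 rmorphM fmorphV rmorphXn /= !ratr_nat.
(* For nonzero y, k + 1 is the least natural number not below |y| M. *)
have [k [kM k_le k_ge k_lt]] : exists k : nat, [/\ (k <= 2 ^ K)%N, k%:R <= `|y| * M,
    `|y| * M <= k%:R + 1 & y != 0 -> k%:R < `|y| * M].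
  have [->|y0] := eqVneq y 0.
    by exists 0%N; rewrite normr0 mul0r add0r ler01.
  have yM : 0 < `|y| * M by rewrite mulr_gt0 ?normr_gt0.
  have exm : exists m : nat, `|y| * M <= m%:R.
    by exists (2 ^ K)%N; rewrite -MN ler_piMl // ltW.
  have [[|m] ym mmin] := ex_minnP exm; first by rewrite leNgt yM in ym.
  have my : m%:R < `|y| * M by rewrite ltNge; apply/negP => /mmin; rewrite ltnn.
  exists m; split; rewrite ?natr1 ?(ltW my) //.
  by apply: ltnW; apply: mmin; rewrite -MN ler_piMl // ltW.
have k_le' : k%:R / M <= `|y| by rewrite ler_pdivrMr.
have k_ge' : `|y| <= k%:R / M + M^-1 by rewrite -[X in _ + X]mul1r -mulrDl ler_pdivlMr.
have km0 : 0 <= k%:R / M by rewrite divr_ge0 // ltW.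
have sq_le : (k%:R / M) ^+ 2 <= y ^+ 2.
  by rewrite -[y ^+ 2]real_normK ?num_real // ler_pXn2r ?nnegrE.
have sq_lt : y != 0 -> (k%:R / M) ^+ 2 < y ^+ 2.
  by move=> y0; rewrite -[y ^+ 2]real_normK ?num_real // ltr_pXn2r ?nnegrE // ltr_pdivrMr // k_lt.
have [y0|y0] := leP 0 y.
  have pE : point (2 ^ K + k) = k%:R / M.
    by rewrite pointE natrD -MN mulrDl divff ?gt_eqF // addrA addNr add0r.
  exists (2 ^ K + k)%N; rewrite pE; split=> //; first by rewrite ltnS mul2n -addnn leq_add2l.
  rewrite (ger0_norm y0) in k_le' k_ge'.
  by rewrite ger0_norm ?subr_ge0 // lerBlDl.
have pE : point (2 ^ K - k) = - (k%:R / M).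
  by rewrite pointE natrB // -MN mulrBl divff ?gt_eqF // addrA addNr add0r.
exists (2 ^ K - k)%N; rewrite pE sqrrN; split=> //.
  by rewrite ltnS (leq_trans (leq_subr _ _)) // leq_pmull.
rewrite (ltr0_norm y0) in k_le' k_ge'.
by rewrite opprK -normrN opprD ger0_norm ?subr_ge0 // lerBlDl.
Qed.

End Rounding.

Section Computes.
Variables (R : realType) (d : nat) (S : tensor R d) (s : 'cV[R[i]]_d.+1).
Hypotheses (d0 : (0 < d)%N) (Ss : associated S s).
Local Notation nu := (spectral_norm BaseC S).

Lemma normc_sub (x y : R[i]) : normc (x - y) = normc (y - x).
Proof. by rewrite -[x - y]opprB; case: (y - x) => a b /=; rewrite !sqrrN. Qed.

Lemma normc_le1 (a b : R[i]) : normc a ^+ 2 + normc b ^+ 2 <= 1 ->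
  normc a <= 1 /\ normc b <= 1.
Proof.
move=> ab; have sq x y : 0 <= x -> x ^+ 2 + y ^+ 2 <= 1 -> x <= 1 :> R.
  move=> x0 xy; rewrite -(@ler_pXn2r _ 2) ?nnegrE // expr1n (le_trans _ xy) //.
  by rewrite lerDl sqr_ge0.
by split; [apply: sq ab | apply: (sq _ (normc a)); rewrite 1?addrC]; rewrite ?normc_ge0.
Qed.

(** Writing K = n + m, the claim reduces to m <= 2^m. *)
Lemma step_small n K : (0 <= coef_mass s) ->
  n%:R + 4 * d%:R * coef_mass s <= K%:R ->
  coef_mass s * (d%:R * (2 * 2 ^- K)) <= 2 ^- n.+1.
Proof.
move=> m0 le; have nK : (n <= K)%N.
  rewrite -(ler_nat R) (le_trans _ le) // lerDl !mulr_ge0 //.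
have [m KE] : exists m, K = (n + m)%N by exists (K - n)%N; rewrite subnKC.
move: le; rewrite KE natrD lerD2l => le.
have mm : m%:R <= 2 ^+ m :> R by rewrite -natrX ler_nat ltnW // ltn_expl.
have -> : coef_mass s * (d%:R * (2 * 2 ^- (n + m))) =
    (4 * d%:R * coef_mass s / 2 ^+ m) * 2 ^- n.+1.
  by rewrite exprD exprS; field; rewrite !expf_neq0.
rewrite ler_piMl ?invr_ge0 ?exprn_ge0 // ler_pdivrMr ?exprn_gt0 // mul1r.
exact: le_trans le mm.
Qed.

Lemma spectral_norm_computed : computes spectral_norm_program s nu.
Proof.
move=> o n os.
(* Half of the allowed error is left to the coefficients and half to the grid. *)
have [K KB] := ceil_nat (rat_bound o d n d.+1).
have BK : rat_bound o d n d.+1 <= K%:R by rewrite leNgt -KB ltnn.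
pose eps : R := 2 ^- n.+1.
have eps2 : 2 ^- n = eps + eps by rewrite /eps exprS; field; rewrite expf_neq0.
have m0 : 0 <= coef_mass s by apply: sumr_ge0 => j _; rewrite mulr_ge0 ?normc_ge0.
have small : coef_mass s * (d%:R * (2 * 2 ^- K)) <= eps.
  apply: step_small m0 _; apply: le_trans (coef_mass_le n os) _.
  by rewrite -(ratr_nat R) ler_rat.
have Re_diff (x y : R[i]) (e : R) :
    normc (x - y) <= e -> complex.Re x <= complex.Re y + e.
  move=> xy; rewrite -lerBlDl; apply: le_trans xy; apply: le_trans (Re_le_normc _).
  by case: x y => [? ?] [? ?]; rewrite /= ler_norm.
have U_bound (a b : R[i]) : normc a ^+ 2 + normc b ^+ 2 < 1 ->
    complex.Re (approx_form o d n a b) <= nu + eps.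
  move=> /ltW ab; have [a1 b1] := normc_le1 ab.
  apply: le_trans (Re_diff _ _ _ (approx_form_error n os a1 b1)) _; rewrite lerD2r.
  apply: le_trans (ler_norm _) _; apply: le_trans (Re_le_normc _) _.
  exact: (binary_form_le_norm d0 Ss).
apply: runs_seq; apply: (runs_compute_bound (d := d) (n := n)) => // st1 [s0 s1 s2].
apply: runs_seq; apply: runs_compute_step s0 s1 s2 KB _ => st2 [t0 t1 t3].
apply: runs_seq; apply: runs_assign.
apply: runs_seq; apply: (runs_grid (U := nu + eps) (h := 2 ^- K) U_bound (@grid_point_count K)).
  split=> //; rewrite /update /= rmorph0 addr_ge0 ?invr_ge0 ?exprn_ge0 //.
  exact: (spectral_norm_ge0 Ss).
move=> st3 best_le best_ge; apply: runs_assign; rewrite /update /=.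
have [a [b [ab1 fE]]] := exists_real_maximizer d0 Ss.
have [a1 b1] : normc a <= 1 /\ normc b <= 1 by apply: normc_le1; rewrite ab1.
have coord (z : R[i]) : normc z <= 1 -> exists i j : nat,
    let g := gauss R (grid_point (2 ^- K) i) (grid_point (2 ^- K) j) in
    [/\ (i < (2 * 2 ^ K).+1)%N, (j < (2 * 2 ^ K).+1)%N, normc (z - g) <= 2 * 2 ^- K,
        normc g ^+ 2 <= normc z ^+ 2 & z != 0 -> normc g ^+ 2 < normc z ^+ 2].
  move=> z1.
  have [i [iN ie il ist]] := round_to_grid K (le_trans (Re_le_normc z) z1).
  have Im1 : `|complex.Im z| <= 1.
    apply: le_trans z1; rewrite -(@ler_pXn2r _ 2) ?nnegrE ?normc_ge0 // normc_sqr.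
    by rewrite real_normK ?num_real // lerDr sqr_ge0.
  have [j [jN je jl jst]] := round_to_grid K Im1.
  exists i, j; split=> //.
  - apply: le_trans (normc_le_ReIm _) _; rewrite mulr2n mulrDl mul1r.
    by case: (z) ie je => [x y] /= ie je; apply: lerD.
  - by rewrite !normc_sqr /= lerD.
  move=> z0; rewrite !normc_sqr /=; have [x0|x0] := eqVneq (complex.Re z) 0.
    rewrite ler_ltD // jst //; apply: contra z0; case: (z) x0 => [x y] /= -> /eqP ->.
    by rewrite eq_complex /= eqxx.
  by rewrite ltr_leD // ist.
have [i1 [i2 [N1 N2 ea la sa]]] := coord a a1.
have [i3 [i4 [N3 N4 eb lb sb]]] := coord b b1.
have := best_ge i1 i2 i3 i4 N1 N2 N3 N4; rewrite /beats.
set a' := gauss R _ _ in ea la sa *; set b' := gauss R _ _ in eb lb sb *.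
have ab' : normc a' ^+ 2 + normc b' ^+ 2 < 1.
  rewrite -ab1; have [a0|a0] := eqVneq a 0; last by rewrite ltr_leD ?sa.
  rewrite ler_ltD // sb //; apply: contra_eq_neq ab1 => ->.
  by rewrite a0 normc0 expr0n addr0 eq_sym oner_neq0.
have [a1' b1'] := normc_le1 (ltW ab').
rewrite -(ltr_rat R) rmorph1 rmorphD /= -!normc_gauss -/a' -/b' => /(_ ab') best_ge'.
have lip := Re_diff _ _ _ (le_trans (binary_form_lipschitz s a1 a1' b1 b1' ea eb) small).
have app : complex.Re (binary_form s a' b') <= complex.Re (approx_form o d n a' b') + eps.
  by apply: Re_diff; rewrite normc_sub; exact: (approx_form_error n os a1' b1').
move: lip; rewrite fE /= => lip.
rewrite ler_norml eps2; apply/andP; split; lra.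
Qed.

End Computes.

Theorem theorem18 (R : realType) :
  exists alg : program,
  forall (d : nat) (S : tensor R d) (s : 'cV[R[i]]_d.+1),
  (2 < d)%N -> symmetric_tensor S -> S != 0 -> associated S s ->
  let p := p_poly s in
  let q := q_poly s in
  let u := u_poly s in
  let v := v_poly s in
  let R1 := [set z : R[i] | root ('X * v - u) z] in
  let R' := [set z : R[i] | root ('X * q - p) z] `&` [set z | z \is Num.real] in
  [/\
    [/\ 'X * v - u = 0 <-> monomial_form s \/ two_root_form s,
        (forall (k : nat) (A : R[i]), (0 < k < d)%N -> A != 0 ->
          (single_entry s k A <->
            forall x : 'cV[R[i]]_2,
              tensor_eval S x = A * 'C(d, k)%:R * x 0 0 ^+ (d - k) * x 1 0 ^+ k) /\
          (single_entry s k A ->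
            forall F : base_field, tensor_over F S ->
              spectral_norm F S =
                normc A * 'C(d, k)%:R
                * (1 - k%:R / d%:R) `^ ((d - k)%:R / 2)
                * (k%:R / d%:R) `^ (k%:R / 2))) &
        (two_root_form s -> computes alg s (spectral_norm BaseC S))],
    (~ (monomial_form s \/ two_root_form s) ->
       finite_set R1 /\
       is_maximum ([set normc (entry s d)] `|` [set phi_ratio s z | z in R1])
                  (spectral_norm BaseC S)) &
    (tensor_over BaseR S ->
       [/\ 'X * q - p = 0 <-> (exists A, sphere_form s A),
           (forall A, sphere_form s A -> spectral_norm BaseR S = normc A) &
           (~ (exists A, sphere_form s A) ->
              is_maximum
                ([set normc (entry s d)] `|` [set phi_ratio s z | z in R'])
                (spectral_norm BaseR S))])].
Proof.
exists spectral_norm_program => d S s d2 _ S0 Ss p q u v R1 R'.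
have d0 : (0 < d)%N by apply: leq_trans d2.
have phi0 : phi_poly s != 0 := phi_neq0 Ss S0.
split.
- split; first exact: fixed_poly_eq0 d0 phi0.
    move=> k A kd _; split; first exact: (single_entryP Ss A kd).
    by move=> sk F _; apply: (spectral_norm_monomial d0 Ss).
  by move=> _; exact: (spectral_norm_computed d0 Ss).
- move=> forms; split; last exact: (spectral_norm_complex d0 Ss phi0).
  apply: finite_roots; apply/negP => /eqP vu; apply: forms.
  exact/(fixed_poly_eq0 d0 phi0).
move=> SR; split; first exact: (sphere_formP d0 phi0).
  by move=> A; exact: (spectral_norm_sphere Ss).
by move=> _; exact: (spectral_norm_real d0 Ss phi0 SR).
Qed.
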